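(* Let $m,n\ge1$. Suppose $1\le i\le\min(m,n)$ and let $\nu^i=((n-i+1)^{m-i+1})$ be the rectangle with $m-i+1$ rows of length $n-i+1$. For $0\le d\le m-2i+2$, $$cs^{(n)}_{R^d(\nu^i);\,n-i+1}(\mathbf{x}_1,\dots,\mathbf{x}_m)=\sum_{X}\Delta_{X\cup[m-i+2,m],\ [1,i-1]\cup X}(\overline{M}),$$ where the sum is over all $(m-2i+2-d)$-element subsets $X$ of $[i,m-i+1]$. More generally, if $1\le a\le b\le m$, $1\le i\le\min(b-a+1,n)$, and $0\le d\le b-a-2i+3$, then $$cs^{(n+a-1)}_{R^d((n-i+1)^{b-a-i+2});\,n-i+1}(\mathbf{x}_a,\dots,\mathbf{x}_b)=\sum_X\Delta_{X\cup[b-i+2,b],\ [a,a+i-2]\cup X}(\overline{M}),$$ where the sum is over all $(b-a-2i+3-d)$-element subsets $X$ of $[a+i-1,b-i+1]$.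
   Context: $[a,b]=\{k\in\mathbb{Z}:a\le k\le b\}$. The $x_i^j$ ($i\in[1,m]$, $j\in[1,n]$) are independent indeterminates over $\mathbb{C}$; for $r\in\mathbb{Z}$ put $x_i^{(r)}=x_i^j$ where $j\in[1,n]$, $j\equiv r-i+1\pmod n$. $\mathbf{x}_i=(x_i^1,\dots,x_i^n)$, $\mathbf{x}^j=(x_1^j,\dots,x_m^j)$. Cylindric shapes. Fix $k\in[1,n]$. A partition $\lambda$ (conjugate $\lambda'$) is $k$-cylindric if $\lambda_1\le k$ and $\lambda'_1-\lambda'_k\le n-k$. For such $\lambda$, $\widetilde\lambda$ is the union of all translates of the Young diagram of $\lambda$ by integer multiples of $(-n+k,k)$ (in matrix coordinates: $n-k$ rows up, $k$ columns right). For $k$-cylindric partitions $\mu\subseteq\lambda$, $\lambda/\mu$ is called a $k$-cylindric shape, and $\widetilde\lambda/\widetilde\mu$ is the corresponding infinite skew shape, i.e. the union of all these translates of $\lambda/\mu$; a partition $\lambda$ is identified with $\lambda/\emptyset$. A semistandard filling $T$ of $\lambda/\mu$ by positive integers is a $k$-cylindric tableau if the filling of $\widetilde\lambda/\widetilde\mu$ obtained by placing $T$ in each translate has weakly increasing rows and strictly increasing columns. For $r\in\mathbb{Z}/n\mathbb{Z}$, $$cs^{(r)}_{\lambda/\mu;k}(\mathbf{x}_a,\dots,\mathbf{x}_b)=\sum_T\prod_{s\in\lambda/\mu}x_{T(s)}^{(c(s)+r)},$$ summed over $k$-cylindric tableaux $T$ of shape $\lambda/\mu$ with entries in $[a,b]$,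 where a cell $s$ in row $p$ and column $q$ has $c(s)=p-q$ (the value for the empty shape is $1$). Removal operation. If $\lambda$ is $k$-cylindric with $\lambda'_1\ge n-k+1$, let $\lambda^\flat$ be the $k$-cylindric partition with conjugate $(\lambda'_2-1,\lambda'_3-1,\dots,\lambda'_k-1,\lambda'_1-n+k-1)$; otherwise $\lambda^\flat$ is undefined. $R(\lambda/\mu)=\lambda^\flat/\mu$ if $\lambda^\flat$ is defined and $\mu\subseteq\lambda^\flat$; otherwise $R(\lambda/\mu)$ is undefined. $R^d$ is the $d$-fold iterate of $R$. In the claim, $R$ is taken with $k=n-i+1$. $W(y_1,\dots,y_m)$ is the $m\times m$ matrix with diagonal entries $y_1,\dots,y_m$, $1$'s in positions $(p+1,p)$, zeros elsewhere; $\overline{M}=W(\mathbf{x}^1)\cdots W(\mathbf{x}^n)$. $\Delta_{A,B}(N)$ is the minor of $N$ with rows $A$ and columns $B$ (in increasing order); the empty minor is $1$. *)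

(* Defs.v *)
From mathcomp Require Import all_boot all_order all_algebra.
From mathcomp Require Import boolp reals complex mpoly.

Set Implicit Arguments.
Unset Strict Implicit.
Unset Printing Implicit Defensive.

Import GRing.Theory Num.Theory.

(* Rows, columns, letters and superscripts are numbered from 1 in the          *)
(* mathematics; an ordinal i : 'I_m stands for the index i.+1.  Cells (p, q)   *)
(* of diagrams are pairs of natural numbers numbered from 1.                   *)

Section Partitions.

(* A partition is its weakly decreasing sequence of nonzero parts. *)
Definition is_partition (la : seq nat) : bool := sorted geq la && (0 \notin la).

Definition part (la : seq nat) (p : nat) : nat := nth 0 la p.-1.

(* [s] is weakly decreasing; zeros at its end do not affect the result. *)
Definition conj_part (s : seq nat) : seq nat :=
  [seq count (fun r => q < r) s | q <- iota 0 (head 0 s)].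

Definition included (mu la : seq nat) : bool :=
  all (fun p => part mu p <= part la p) (iota 1 (size mu)).

Definition cylindric (n k : nat) (la : seq nat) : bool :=
  [&& is_partition la, part la 1 <= k &
      part (conj_part la) 1 <= part (conj_part la) k + (n - k)].

Definition flat (n k : nat) (la : seq nat) : option (seq nat) :=
  let la' := conj_part la in
  if cylindric n k la && (n - k + 1 <= part la' 1) then
    Some (conj_part (rcons [seq part la' j - 1 | j <- iota 2 (k - 1)]
                           (part la' 1 - (n - k) - 1)))
  else None.

(* The shape lambda/mu is the pair (lambda, mu). *)
Definition skew_shape : Type := seq nat * seq nat.

Definition removal (n k : nat) (s : skew_shape) : option skew_shape :=
  if flat n k s.1 is Some la then
    if included s.2 la then Some (la, s.2) else None
  else None.

Definition removal_iter (n k d : nat) (s : skew_shape) : option skew_shape :=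
  iter d (obind (removal n k)) (Some s).

Definition cells (s : skew_shape) : seq (nat * nat) :=
  [seq (p, q) | p <- iota 1 (size s.1),
                q <- iota (part s.2 p).+1 (part s.1 p - part s.2 p)].

End Partitions.

Local Open Scope ring_scope.

Section Tableaux.

Variables (n k m : nat) (s : skew_shape).

Definition filling : finType := {ffun seq_sub (cells s) -> 'I_m}.

Definition translate (t : int) (c : nat * nat) : int * int :=
  (c.1%:Z - t * (n - k)%N%:Z, c.2%:Z + t * k%:Z).

(* The cells of the infinite shape are the translates of the cells c of s, and *)
(* the entry of every translate of c is T c.                                   *)
Definition cylindric_tableau (T : filling) : Prop :=
  (forall (c c' : seq_sub (cells s)) (t t' : int),
     let u := translate t (val c) in let u' := translate t' (val c') in
     u.1 = u'.1 -> u.2 <= u'.2 -> (T c <= T c')%N) /\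
  (forall (c c' : seq_sub (cells s)) (t t' : int),
     let u := translate t (val c) in let u' := translate t' (val c') in
     u.2 = u'.2 -> u.1 < u'.1 -> (T c < T c')%N).

End Tableaux.

Section LoopSchur.

Variables (R : realType) (m n : nat).

Definition indet (i : 'I_m) (j : 'I_n) : {mpoly R[i][m * n]} :=
  'X_(mxvec_index i j).

(* x_i^(r); the default value 0 is never used when n > 0. *)
Definition indet_mod (i : 'I_m) (r : int) : {mpoly R[i][m * n]} :=
  if [pick j : 'I_n | (j.+1%:Z == r - i.+1%:Z + 1 %[mod n%:Z])%Z] is Some j
  then indet i j else 0.

Definition content (c : nat * nat) : int := c.1%:Z - c.2%:Z.

(* cs^(r)_{s;k}(x_a, ..., x_b); the residue r mod n is given by an integer. *)
Definition cyl_loop_schur (k a b : nat) (r : int) (s : skew_shape) :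
    {mpoly R[i][m * n]} :=
  \sum_(T : filling m s | `[< cylindric_tableau n k T >] &&
                          [forall c, (a <= (T c).+1 <= b)%N])
    \prod_(c : seq_sub (cells s)) indet_mod (T c) (content (val c) + r).

(* An undefined shape contributes 0. *)
Definition cyl_loop_schur_opt (k a b : nat) (r : int) (o : option skew_shape) :
    {mpoly R[i][m * n]} :=
  if o is Some s then cyl_loop_schur k a b r s else 0.

Definition whirl (y : 'I_m -> {mpoly R[i][m * n]}) :
    'M[{mpoly R[i][m * n]}]_m :=
  \matrix_(p, q) if p == q then y p else (p == q.+1 :> nat)%:R.

Definition Mbar : 'M[{mpoly R[i][m * n]}]_m :=
  \big[mulmx/1%:M]_(j < n) whirl (fun i => indet i j).

End LoopSchur.

(* [enum_val] lists a set of ordinals in increasing order; minors only make    *)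
(* sense for index sets of the same size, and are set to 0 otherwise.          *)
Definition minor (S : comNzRingType) (m : nat) (A B : {set 'I_m}) (N : 'M[S]_m) :
    S :=
  match #|A| =P #|B| with
  | ReflectT eAB =>
      \det (mxsub (@enum_val _ (mem A))
                  (fun v => @enum_val _ (mem B) (cast_ord eAB v)) N)
  | ReflectF _ => 0
  end.

Definition segment (m c d : nat) : {set 'I_m} :=
  [set p : 'I_m | (c <= p.+1 <= d)%N].

(* Main.v *)
From HB Require Import structures.
Require Import Defs.
From mathcomp Require Import all_boot all_order all_algebra fingroup perm.
From mathcomp Require Import boolp reals complex mpoly.
From mathcomp Require Import zify.

(* By Cauchy-Binet, each minor of [Mbar] is a sum over chains of sets S_0,    *)
(* ..., S_n, that is, over families of vertex-disjoint paths which in one     *)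
(* unit of time stay at height h (weight x_h^j) or move down by 1.  Summing   *)
(* over X glues time n to time 0, so the paths live on a cylinder; lifted to  *)
(* its universal cover, path p is the p-th row of the periodic tableau, whose *)
(* entries are the heights at which the path stays.  Both objects are encoded *)
(* by the function F h t, the largest label of a path at height at most h at  *)
(* time t: for fixed t, the heights where F increases form the set S_t, and   *)
(* along a diagonal h + t = const they are the entries of the corresponding   *)
(* diagonal of the tableau.  If the shape after d removals is undefined, no   *)
(* such function exists.                                                      *)

Set Implicit Arguments.
Unset Strict Implicit.
Unset Printing Implicit Defensive.

Import Order.TTheory GRing.Theory Num.Theory.
Local Open Scope ring_scope.

(** * Minors of products *)

(** Put N = i - 1, k = n - i + 1 and r = b - a + 1 - N - d, the common size of the row and column
    sets. A minor of one factor W(x^j) is 0 or a product of diagonal entries ([minor_bidiagonal]),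
    so Cauchy-Binet ([minor_mulmx]) expands a minor of [Mbar] into one monomial per chain of
    interlaced sets ([minor_prod_bidiagonal]).

    A removal moves the periodic diagram one step up and one step left. Hence the columns of the
    d-fold removal of the rectangle have the closed form [removed_col], and the removal is defined
    exactly when column k does not become negative ([removal_iter_rectangle]).

    Height functions F link the two sides. A cell (p, q) with entry h corresponds to path p staying
    at height h from time t to t + 1, where h + t = n + a - 1 - q + p; in terms of F this reads F
    (h-1) (t+1) < p <= F h t. For tableaux, [hf_step] expresses weak increase along rows and [hf_up]
    strict increase down columns. For chains, [hf_step] and [hf_diag] are the two interlacing
    inequalities and [hf_up] says that paths do not meet. The boundary values of F describe the two
    rims of the shape, and equally the parts of the end sets other than X. Tableaux and chains each
    determine F on the strip a - 1 <= h <= b and are recovered from it ([tableau_of_heights],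
    [heights_of_tableau], [heights_of_chain], [chain_of_heights]). Weights agree because cells
    correspond to stays modulo the period ([tableau_chain_weight]). *)

Section CauchyBinet.
Variable S : comNzRingType.

(** Multilinearity in the rows; dropping the non-injective f and grouping the others by image then
    gives Cauchy-Binet. *)
Lemma det_mulmx_ffun r m (X : 'M[S]_(r, m)) (Y : 'M[S]_(m, r)) :
  \det (X *m Y) =
  \sum_(f : {ffun 'I_r -> 'I_m}) (\prod_i X i (f i)) * \det (rowsub f Y).
Proof.
under [RHS]eq_bigr => f _ do rewrite mulr_sumr.
rewrite exchange_big /=; apply: eq_bigr => s _.
under eq_bigr => i _ do rewrite mxE.
rewrite bigA_distr_bigA /= mulr_sumr; apply: eq_bigr => f _.
rewrite big_split /= mulrCA; congr (_ * (_ * _)).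
by apply: eq_bigr => i _; rewrite mxE.
Qed.

Lemma det_rowsub_noninj r m (f : 'I_r -> 'I_m) (Y : 'M[S]_(m, r)) :
  ~~ injectiveb f -> \det (rowsub f Y) = 0.
Proof.
move=> /injectivePn[i [j nij fij]].
by apply: (determinant_alternate nij) => l; rewrite !mxE fij.
Qed.

(** The size r is a separate parameter, so that two sets of equal size are listed by the same index
    type. *)
Definition listing m (A : {set 'I_m}) r (eA : r = #|A|) (u : 'I_r) : 'I_m :=
  enum_val (cast_ord eA u).

Lemma listing_inj m (A : {set 'I_m}) r (eA : r = #|A|) : injective (listing eA).
Proof. by move=> u v /enum_val_inj /cast_ord_inj. Qed.

Lemma listing_in m (A : {set 'I_m}) r (eA : r = #|A|) u : listing eA u \in A.
Proof. exact: enum_valP. Qed.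

Lemma listing_onto m (A : {set 'I_m}) r (eA : r = #|A|) x :
  x \in A -> exists u, listing eA u = x.
Proof.
move=> xA; exists (cast_ord (esym eA) (enum_rank_in xA x)).
by rewrite /listing cast_ordKV enum_rankK_in.
Qed.

Lemma minor_listing m (A B : {set 'I_m}) (P : 'M[S]_m) r
    (eA : r = #|A|) (eB : r = #|B|) :
  minor A B P = \det (mxsub (listing eA) (listing eB) P).
Proof.
subst r; rewrite /minor; case: eqP => // eAB.
congr (\det _); apply/matrixP => i j; rewrite !mxE /listing cast_ord_id.
by rewrite (eq_irrelevance eAB eB).
Qed.

Lemma minor_card_neq m (A B : {set 'I_m}) (P : 'M[S]_m) :
  #|A| <> #|B| -> minor A B P = 0.
Proof. by move=> nAB; rewrite /minor; case: eqP. Qed.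

(** The injections with image C are the listing of C precomposed with permutations; permuting the
    rows of Y produces the signs of the determinant of X. *)
Lemma sum_injections_image m r (C : {set 'I_m}) (eC : r = #|C|)
    (X : 'M[S]_(r, m)) (Y : 'M[S]_(m, r)) :
  \sum_(f : {ffun 'I_r -> 'I_m} | injectiveb f && (f @: setT == C))
     (\prod_i X i (f i)) * \det (rowsub f Y) =
  \det (colsub (listing eC) X) * \det (rowsub (listing eC) Y).
Proof.
pose h (s : 'S_r) := [ffun i => listing eC (s i)] : {ffun 'I_r -> 'I_m}.
have h_inj : injective h.
  move=> s t /ffunP st; apply/permP => i.
  by have := st i; rewrite !ffunE => /listing_inj.
rewrite (eq_bigl (fun f => f \in h @: setT)); last first.
  move=> f; apply/andP/imsetP => [[/injectiveP finj /eqP fC]|[s _ ->]].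
    have ex i : exists u, listing eC u = f i.
      by apply: listing_onto; rewrite -fC imset_f.
    pose s0 i := odflt i [pick u | listing eC u == f i].
    have s0E i : listing eC (s0 i) = f i.
      rewrite /s0; case: pickP => [u /eqP // | no].
      by have [u fu] := ex i; have := no u; rewrite fu eqxx.
    have s0_inj : injective s0.
      by move=> i j ij; apply: finj; rewrite -!s0E ij.
    by exists (perm s0_inj) => //; apply/ffunP => i; rewrite ffunE permE s0E.
  have hinj : injective (h s).
    by move=> i j; rewrite !ffunE => /listing_inj /perm_inj.
  split; first by apply/injectiveP.
  rewrite eqEcard card_imset // cardsT card_ord -eC leqnn andbT.
  by apply/subsetP => x /imsetP[i _ ->]; rewrite ffunE listing_in.
rewrite big_imset /=; last by move=> s t _ _; apply: h_inj.
rewrite [X in X * _]/determinant mulr_suml.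
rewrite (eq_bigl predT) => [|s]; last by rewrite inE.
apply: eq_bigr => s _.
have -> : rowsub (h s) Y = row_perm s (rowsub (listing eC) Y).
  by apply/matrixP => i j; rewrite !mxE ffunE.
rewrite row_permE det_mulmx det_perm mulrA (mulrC (\prod_i _)).
congr (_ * _ * _); apply: eq_bigr => i _.
by rewrite ffunE !mxE.
Qed.

Theorem minor_mulmx m (A B : {set 'I_m}) (N P : 'M[S]_m) :
  minor A B (N *m P) = \sum_C minor A C N * minor C B P.
Proof.
have [eAB|nAB] := eqVneq #|A| #|B|; last first.
  rewrite minor_card_neq; last exact/eqP.
  rewrite big1 // => C _; have [eAC|nAC] := eqVneq #|A| #|C|.
    by rewrite (@minor_card_neq _ C B) ?mulr0 // -eAC; apply/eqP.
  by rewrite minor_card_neq ?mul0r //; apply/eqP.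
rewrite (minor_listing _ erefl eAB).
have -> : mxsub (listing erefl) (listing eAB) (N *m P) =
    rowsub (listing (erefl #|A|)) N *m colsub (listing eAB) P.
  by apply/matrixP => i j; rewrite !mxE; apply: eq_bigr => l _; rewrite !mxE.
rewrite det_mulmx_ffun (bigID (fun f : {ffun _ -> _} => injectiveb f)) /=.
rewrite [X in _ + X]big1 ?addr0; last first.
  by move=> f nf; rewrite det_rowsub_noninj ?mulr0.
rewrite (partition_big (fun f : {ffun _} => f @: setT) predT) //=.
apply: eq_bigr => C _.
have [eAC|/eqP nAC] := eqVneq #|A| #|C|; last first.
  rewrite minor_card_neq // mul0r big1 // => f /andP[/injectiveP finj /eqP fC].
  by case: nAC; rewrite -fC card_imset // cardsT card_ord.
rewrite (sum_injections_image eAC) (minor_listing _ erefl eAC).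
rewrite (minor_listing _ eAC eAB).
congr (_ * _); congr (\det _);
  by apply/matrixP => i j; rewrite !mxE.
Qed.

Lemma minor_scalar1 m (A B : {set 'I_m}) :
  minor A B (1%:M : 'M[S]_m) = (A == B)%:R.
Proof.
have [<-|nAB] := eqVneq A B.
  rewrite (minor_listing _ erefl erefl) -[RHS](det1 _ #|A|).
  congr (\det _); apply/matrixP => i j; rewrite !mxE.
  by rewrite (inj_eq (@listing_inj _ _ _ _)).
have [eAB|/eqP ?] := eqVneq #|A| #|B|; last by rewrite minor_card_neq.
have /subsetPn[x xA xB] : ~~ (A \subset B).
  by apply: contra nAB => sAB; rewrite eqEcard sAB eAB leqnn.
rewrite (minor_listing _ erefl eAB).
have [u ux] := listing_onto (erefl #|A|) xA.
(* The row indexed by an element of A outside B is zero. *)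
rewrite (expand_det_row _ u) big1 // => v _; rewrite !mxE ux.
case: eqP => [xv|]; last by rewrite mul0r.
by rewrite xv listing_in in xB.
Qed.

End CauchyBinet.

(** * Expansion of iterated kernels over chains *)

Section Chains.
Variables (S : comNzRingType) (T : finType).

Lemma sum_ffunS n (F : {ffun 'I_n.+2 -> T} -> S) :
  \sum_f F f = \sum_(g : {ffun 'I_n.+1 -> T}) \sum_c
     F [ffun i => if unlift ord_max i is Some j then g j else c].
Proof.
rewrite pair_big /=.
pose h (gc : {ffun 'I_n.+1 -> T} * T) : {ffun 'I_n.+2 -> T} :=
  [ffun i => if unlift ord_max i is Some j then gc.1 j else gc.2].
pose h' (f : {ffun 'I_n.+2 -> T}) := ([ffun j => f (lift ord_max j)], f ord_max).
rewrite (reindex h); last first.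
  exists h' => [[g c]|f] _.
    congr pair; last by rewrite ffunE unlift_none.
    by apply/ffunP => j; rewrite !ffunE liftK.
  apply/ffunP => i; rewrite !ffunE /=.
  by case: unliftP => [j ->|->] //; rewrite ffunE.
by apply: eq_bigr => -[g c].
Qed.

(** Transfer-matrix expansion; K j will be the minors of the j-th factor, and the recursion for P is
    Cauchy-Binet. *)
Lemma kernel_chains (K : nat -> T -> T -> S) (P : nat -> T -> T -> S) :
  (forall A B, P 0 A B = (A == B)%:R) ->
  (forall n A B, P n.+1 A B = \sum_C P n A C * K n C B) ->
  forall n A B, P n A B =
    \sum_(f : {ffun 'I_n.+1 -> T} | (f ord0 == A) && (f ord_max == B))
      \prod_(j < n) K j (f (inord j)) (f (inord j.+1)).
Proof.
move=> P0 PS; elim=> [|n IHn] A B.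
  rewrite P0; have [<-|nAB] := eqVneq A B.
    rewrite (big_pred1 [ffun=> A]) ?big_ord0 // => f /=.
    apply/andP/eqP => [[/eqP fA _]|->]; last by rewrite !ffunE eqxx.
    by apply/ffunP => i; rewrite ord1 ffunE fA.
  rewrite big_pred0 // => f; apply/andP => -[/eqP fA /eqP fB].
  by case/eqP: nAB; rewrite -fA -fB; congr (f _); apply: val_inj.
rewrite PS [RHS]big_mkcond [RHS]sum_ffunS /=.
under eq_bigr => C _ do rewrite IHn mulr_suml.
rewrite [LHS](exchange_big_dep (fun f : {ffun 'I_n.+1 -> T} => f ord0 == A)) /=;
  last by move=> C f _ /andP[].
rewrite [LHS]big_mkcond; apply: eq_bigr => f _ /=.
set h := fun c => _; pose f' (c : T) := [ffun i => if unlift ord_max i is Some j then f j else c].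
have f'w c (j : nat) : (j <= n)%N -> f' c (inord j) = f (inord j).
  move=> jn; have -> : inord j = lift ord_max (inord j : 'I_n.+1) :> 'I_n.+2.
    by apply: ord_inj; rewrite lift_max !inordK // ltnS // leqW.
  by rewrite ffunE liftK.
have f'm c : f' c ord_max = c by rewrite ffunE unlift_none.
have f'0 c : f' c ord0 = f ord0.
  have := @f'w c 0 isT; rewrite (_ : inord 0 = ord0); last by apply: val_inj; rewrite /= inordK.
  by move=> ->; congr (f _); apply: val_inj; rewrite /= inordK.
rewrite [RHS](eq_bigr (fun c => if (f ord0 == A) && (c == B) then
    (\prod_(j < n) K j (f (inord j)) (f (inord j.+1))) * K n (f ord_max) c
    else 0)); last first.
  move=> c _; rewrite -/(f' c) f'0 f'm; case: ifP => // _.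
  rewrite big_ord_recr /=; congr (_ * _).
    by apply: eq_bigr => j _; rewrite !f'w // ltnW.
  rewrite f'w // (_ : inord n = ord_max :> 'I_n.+1); last by apply: val_inj; rewrite /= inordK.
  by rewrite (_ : inord n.+1 = ord_max) ?f'm //; apply: val_inj; rewrite /= inordK.
case: ifP => [fA|fA]; last by rewrite big1 //= => c _; rewrite fA.
rewrite -big_mkcond /= big_pred1_eq.
by rewrite (big_pred1 (f ord_max)) // => C /=; rewrite fA andTb eq_sym.
Qed.
End Chains.

(** The predicate holds exactly on an initial segment of s. This serves both ranks in a set and
    conjugate partitions. *)
Lemma ltn_count_sorted (T : Type) (le : rel T) (p : pred T) (x0 : T) s i :
  transitive le -> (forall x y, le x y -> p y -> p x) ->
  sorted le s -> (i < size s)%N -> (i < count p s)%N = p (nth x0 s i).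
Proof.
move=> le_tr p_le; elim: s i => // x s IHs i /= xs.
have [px|npx] := boolP (p x).
  case: i => [//|i] si; rewrite add1n !ltnS /= IHs //.
  exact: path_sorted xs.
have npall : ~~ has p s.
  rewrite -all_predC; have := order_path_min le_tr xs.
  by apply: sub_all => y /p_le h /=; apply: contra npx.
rewrite add0n => si; have -> : count p s = 0%N.
  by apply/eqP; rewrite -leqn0 leqNgt -has_count.
rewrite ltn0; case: i si => [|i] /= si; first by rewrite (negbTE npx).
by apply/esym/negbTE; apply: contra npall => pn; apply/(has_nthP x0); exists i.
Qed.

(** * Counting functions and interlacing of sets *)

Section Rank.
Variable m : nat.
Implicit Types A B : {set 'I_m}.

(** In the numbering from 1, this counts the elements of height at most h. *)
Definition cnt A (h : nat) : nat := #|[set x in A | (x < h)%N]|.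

Lemma cnt0 A : cnt A 0 = 0%N.
Proof. by apply/eqP; rewrite cards_eq0; apply/eqP/setP => x; rewrite !inE andbF. Qed.

Lemma cnt_all A h : (m <= h)%N -> cnt A h = #|A|.
Proof.
move=> mh; congr #|pred_of_set _|; apply/setP => x; rewrite !inE.
by rewrite (leq_trans (ltn_ord x) mh) andbT.
Qed.

Lemma cntS A (x : 'I_m) : cnt A x.+1 = (cnt A x + (x \in A))%N.
Proof.
have -> : cnt A x.+1 = #|[set y in A | (y < x)%N] :|: [set y in A | y == x]|.
  congr #|pred_of_set _|; apply/setP => y; rewrite !inE -andb_orr.
  by rewrite ltnS leq_eqVlt orbC.
rewrite cardsU (_ : _ :&: _ = set0) ?cards0 ?subn0; last first.
  by apply/setP => y; rewrite !inE; case: eqP => [->|]; rewrite ?ltnn ?andbF.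
congr (_ + _)%N; case: (boolP (x \in A)) => xA.
  have -> : [set y in A | y == x] = [set x]; last by rewrite cards1.
  by apply/setP => y; rewrite !inE andbC; case: eqP => // ->.
apply/eqP; rewrite cards_eq0; apply/eqP/setP => y; rewrite !inE andbC.
by case: eqP => // ->; rewrite (negbTE xA).
Qed.

Lemma cnt_count A h : cnt A h = count (fun x : 'I_m => (x < h)%N) (enum A).
Proof.
rewrite -size_filter /cnt -(card_uniqP (filter_uniq _ (enum_uniq _))).
by apply: eq_card => x; rewrite inE mem_filter mem_enum andbC.
Qed.

Lemma sorted_enum A : sorted (fun x y : 'I_m => (x < y)%N) (enum A).
Proof.
rewrite {1}/enum_mem -enumT.
apply: sorted_filter; first by move=> y x z; apply: ltn_trans.
rewrite -(@sorted_map _ _ val ltn) val_enum_ord; exact: iota_ltn_sorted.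
Qed.

Lemma ltn_cnt A r (eA : r = #|A|) (u : 'I_r) h :
  (u < cnt A h)%N = (listing eA u < h)%N.
Proof.
rewrite cnt_count /listing.
have x0 : 'I_m by apply: listing eA u.
rewrite (ltn_count_sorted x0 _ _ (sorted_enum A)).
- by rewrite (enum_val_nth x0).
- by move=> y x z; apply: ltn_trans.
- by move=> x y /ltn_trans xy /xy.
- by rewrite -cardE -eA.
Qed.

Lemma cnt_listing A r (eA : r = #|A|) (u : 'I_r) : cnt A (listing eA u) = u.
Proof.
apply/eqP; rewrite eqn_leq; apply/andP; split.
  by rewrite leqNgt (ltn_cnt eA) ltnn.
have : (u < cnt A (listing eA u).+1)%N by rewrite (ltn_cnt eA).
by rewrite cntS listing_in addn1 ltnS.
Qed.

Lemma listing_ltn A r (eA : r = #|A|) (u v : 'I_r) :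
  (u < v)%N -> (listing eA u < listing eA v)%N.
Proof. by move=> uv; rewrite -(ltn_cnt eA) cnt_listing. Qed.

Lemma cnt_le A h : (cnt A h <= #|A|)%N.
Proof. by apply: subset_leq_card; apply/subsetP => x; rewrite inE => /andP[]. Qed.

(** Each element of B equals the element of A of the same rank or lies one below it
    ([interlaced_listing]). Counts are used because they become values of height functions. *)
Definition interlaced A B : bool :=
  [forall h : 'I_m.+1, cnt A h <= cnt B h <= cnt A h.+1]%N.

(** For interlaced sets, equal counts below x mean that the element of B of the same rank as x is at
    least x, hence is x itself. *)
Definition stays A B (x : 'I_m) : bool := (x \in A) && (cnt B x == cnt A x).

Lemma interlacedP A B :
  reflect (forall h, cnt A h <= cnt B h <= cnt A h.+1)%N (interlaced A B).
Proof.
apply: (iffP forallP) => [AB h|AB h]; last exact: AB.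
have [hm|hm] := leqP h m; first exact: (AB (Ordinal (hm : (h < m.+1)%N))).
have := AB ord_max; have mh := ltnW hm.
by rewrite /= !(cnt_all _ (leqnn m), cnt_all _ (leqnSn m), cnt_all _ mh, cnt_all _ (leqW mh)).
Qed.

Lemma interlaced_card A B : interlaced A B -> #|A| = #|B|.
Proof.
move=> /interlacedP/(_ m); rewrite !cnt_all // => /andP[AB BA].
by apply/eqP; rewrite eqn_leq AB BA.
Qed.

Lemma interlaced_listing A B r (eA : r = #|A|) (eB : r = #|B|) :
  interlaced A B =
  [forall u, listing eB u <= listing eA u <= (listing eB u).+1]%N.
Proof.
apply/interlacedP/forallP => [AB u|AB h].
  apply/andP; split; rewrite -ltnS.
    rewrite -(ltn_cnt eB); have /andP[le _] := AB (listing eA u).+1.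
    by apply: leq_trans le; rewrite (ltn_cnt eA).
  rewrite -(ltn_cnt eA); have /andP[_ le] := AB (listing eB u).+1.
  by apply: leq_trans le; rewrite (ltn_cnt eB).
apply/andP; split; rewrite leqNgt; apply/negP => lt.
  have ur : (cnt B h < r)%N by rewrite eA (leq_trans lt) // cnt_le.
  have /andP[le _] := AB (Ordinal ur).
  have := lt; rewrite -[cnt B h]/(val (Ordinal ur)) (ltn_cnt eA) => /(leq_ltn_trans le).
  by rewrite -(ltn_cnt eB) ltnn.
have ur : (cnt A h.+1 < r)%N by rewrite eB (leq_trans lt) // cnt_le.
have /andP[_ le] := AB (Ordinal ur).
have := lt; rewrite -[cnt A h.+1]/(val (Ordinal ur)) (ltn_cnt eB) -ltnS.
move=> /(leq_ltn_trans le).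
by rewrite -(ltn_cnt eA) ltnn.
Qed.

End Rank.

(** An increasing self-map of an ordinal lies above the identity; this applies to s and to its
    inverse. *)
Lemma perm_ltn_id r (s : 'S_r) :
  {homo s : u v / (u < v)%N >-> (u < v)%N} -> s = 1%g.
Proof.
have ge_id (f : 'I_r -> 'I_r) : {homo f : u v / (u < v)%N >-> (u < v)%N} ->
    forall u : 'I_r, (u <= f u)%N.
  move=> fh [u]; elim: u => [|u IHu] ur //=.
  exact: leq_ltn_trans (IHu (ltnW ur)) (fh (Ordinal (ltnW ur)) (Ordinal ur) _).
move=> sh; apply/permP => u; rewrite perm1; apply/val_inj/eqP.
rewrite eqn_leq (ge_id _ sh) andbT.
have := @ge_id (s^-1)%g _ (s u); rewrite permK; apply=> v w vw.
rewrite ltnNge leq_eqVlt; apply/norP; split.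
  by apply: contraTN vw => /eqP/val_inj/perm_inj ->; rewrite ltnn.
by apply: contraTN vw => /sh; rewrite !permKV -leqNgt => /ltnW.
Qed.

(** * Minors of bidiagonal matrices and of their products *)

Section Bidiagonal.
Variables (S : comNzRingType) (m : nat) (y : 'I_m -> S).

Definition bidiagonal : 'M[S]_m :=
  \matrix_(p, q) if p == q then y p else (p == q.+1 :> nat)%:R.

(* A permutation with a nonzero term maps each chosen row to a column at       *)
(* distance 0 or 1 below it, so it is increasing, hence the identity.          *)
Lemma det_mxsub_bidiagonal (A B : {set 'I_m}) r (eA : r = #|A|) (eB : r = #|B|) :
  \det (mxsub (listing eA) (listing eB) bidiagonal) =
  \prod_u bidiagonal (listing eA u) (listing eB u).
Proof.
rewrite /determinant (bigD1 1%g) //= [X in _ + X]big1 ?addr0.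
  rewrite odd_perm1 expr0 mul1r; apply: eq_bigr => u _.
  by rewrite !mxE perm1.
move=> s ns1.
have [/forallP near|/forallPn[u far]] :=
    boolP [forall u, listing eB (s u) <= listing eA u <= (listing eB (s u)).+1]%N.
  case/eqP: ns1; apply: perm_ltn_id => u v uv.
  have /andP[lu _] := near u; have /andP[_ lv] := near v.
  have luv : (listing eB (s u) <= listing eB (s v))%N.
    rewrite -ltnS; apply: leq_trans lv; apply: leq_ltn_trans lu _.
    exact: listing_ltn.
  rewrite ltnNge leq_eqVlt; apply/norP; split.
    by apply: contraTN uv => /eqP/val_inj/perm_inj ->; rewrite ltnn.
  by apply: contraTN luv => /(listing_ltn eB); rewrite -ltnNge.
rewrite (bigD1 u) //= !mxE.
case: eqP => [uv|_]; first by rewrite uv leqnn leqnSn in far.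
case: eqP => [uv|_]; first by rewrite uv leqnSn leqnn in far.
by rewrite mul0r mulr0.
Qed.

(** Only the order-preserving pairing of A with B contributes: a pair gives y x if the path stays at
    x, 1 if it moves down by one, and 0 otherwise. *)
Lemma minor_bidiagonal (A B : {set 'I_m}) :
  minor A B bidiagonal =
  if interlaced A B then \prod_(x | stays A B x) y x else 0.
Proof.
have [eAB|/eqP nAB] := eqVneq #|A| #|B|; last first.
  by rewrite minor_card_neq //; case: ifP => // /interlaced_card.
rewrite (minor_listing _ erefl eAB) det_mxsub_bidiagonal.
rewrite (interlaced_listing erefl eAB); case: ifP => [/forallP AB|/negbT].
  rewrite /stays big_mkcondr /=.
  rewrite [RHS](eq_bigr (fun x : 'I_m => if cnt B x == cnt A x then y x else 1)) // [RHS]big_enum_val /=.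
  apply: eq_bigr => u _.
  have -> : enum_val u = listing erefl u by rewrite /listing cast_ord_id.
  rewrite (cnt_listing erefl) mxE; have /andP[l1 l2] := AB u.
  case: (eqVneq (listing erefl u) (listing eAB u)) => [->|nu].
    by rewrite cnt_listing eqxx.
  have /eqP auE : listing erefl u == (listing eAB u).+1 :> nat.
    by rewrite eqn_leq l2 ltn_neqAle l1 andbT eq_sym.
  rewrite auE eqxx; have := ltn_cnt eAB u (listing (erefl #|A|) u).
  by rewrite auE ltnSn; case: eqP => // -> ; rewrite ltnn.
move=> /forallPn[u far]; rewrite (bigD1 u) //= !mxE.
case: eqP => [uv|_]; first by rewrite uv leqnn leqnSn in far.
case: eqP => [uv|_]; first by rewrite uv leqnSn leqnn in far.
by rewrite mul0r.
Qed.

End Bidiagonal.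

(** Lets the product defining [Mbar] be split by the lemmas on iterated monoid operations. *)
HB.instance Definition _ (S : comNzRingType) m :=
  Monoid.isLaw.Build 'M[S]_m 1%:M mulmx (@mulmxA S m m m m)
    (@mul1mx S m m) (@mulmx1 S m m).

Lemma minor_prod_bidiagonal (S : comNzRingType) m n (y : nat -> 'I_m -> S)
    (A B : {set 'I_m}) :
  minor A B (\big[mulmx/1%:M]_(j < n) bidiagonal (y j)) =
  \sum_(f : {ffun 'I_n.+1 -> {set 'I_m}} |
          [&& f ord0 == A, f ord_max == B &
              [forall j : 'I_n, interlaced (f (inord j)) (f (inord j.+1))]])
    \prod_(j < n) \prod_(x | stays (f (inord j)) (f (inord j.+1)) x) y j x.
Proof.
rewrite (@kernel_chains _ _ (fun j A B => minor A B (bidiagonal (y j)))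
  (fun n A B => minor A B (\big[mulmx/1%:M]_(j < n) bidiagonal (y j)))).
- under [RHS]eq_bigl => f do rewrite andbA.
  rewrite [RHS]big_mkcondr /=; apply: eq_bigr => f _.
  case: ifP => [/forallP fI|/negbT/forallPn[j nj]].
    by apply: eq_bigr => j _; rewrite minor_bidiagonal fI.
  by rewrite (bigD1 j) //= minor_bidiagonal (negbTE nj) mul0r.
- by move=> C D; rewrite big_ord0 minor_scalar1.
- by move=> l C D; rewrite big_ord_recr /= minor_mulmx.
Qed.

(** * Shapes obtained from a rectangle by removals *)

Section ConjugatePartitions.
Implicit Types (la s : seq nat) (p q : nat).

Lemma geq_trans : transitive geq.
Proof. by move=> y x z /= xy yz; apply: leq_trans yz xy. Qed.

Lemma conj_part_count s q : sorted geq s -> (0 < q)%N ->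
  part (conj_part s) q = count (fun x => q <= x)%N s.
Proof.
move=> s_dec q0; rewrite /part /conj_part.
have [lt|ge] := ltnP q.-1 (head 0 s)%N.
  rewrite (nth_map 0%N) ?size_iota // nth_iota // add0n.
  by apply: eq_count => x /=; rewrite prednK.
rewrite nth_default ?size_map ?size_iota //.
apply/esym/eqP; rewrite -leqn0 leqNgt -has_count; apply/hasPn => x xs.
rewrite -ltnNge; apply: leq_ltn_trans (_ : (head 0 s < q)%N); last by lia.
case: s s_dec ge xs => //= y s ys _; rewrite inE => /predU1P[->//|xs].
by have /allP/(_ x xs) := order_path_min geq_trans ys.
Qed.

(** Both sides say that the cell (p, q) lies in the diagram. *)
Lemma leq_conj_part s p q : sorted geq s -> (0 < p)%N -> (0 < q)%N ->
  (p <= part (conj_part s) q)%N = (q <= part s p)%N.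
Proof.
move=> s_dec p0 q0; rewrite conj_part_count // /part.
have [lt|ge] := ltnP p.-1 (size s).
  rewrite -(ltn_count_sorted (p := fun x => (q <= x)%N) 0%N geq_trans _ s_dec lt).
    by rewrite prednK.
  by move=> x y /= yx qy; apply: leq_trans yx.
rewrite nth_default //; have := count_size (fun x => (q <= x)%N) s; lia.
Qed.

Lemma conj_part_partition s : sorted geq s -> is_partition (conj_part s).
Proof.
move=> s_dec; apply/andP; split.
  rewrite /conj_part sorted_map.
  apply: sub_sorted (iota_ltn_sorted 0 (head 0%N s)) => x y /= xy.
  by apply: sub_count => z /= /(ltn_trans xy).
apply/negP => /mapP[q]; rewrite mem_iota add0n => /andP[_ qs] /esym/eqP.
rewrite -leqn0 leqNgt -has_count => /negP[]; apply/hasP.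
by case: s s_dec qs => //= y s _ qy; exists y; rewrite ?inE ?eqxx.
Qed.

Lemma partition_sorted la : is_partition la -> sorted geq la.
Proof. by case/andP. Qed.

(** Since s may end in zeros, as the sequence in [flat] may, the parts are recovered but not the
    sequence itself. *)
Lemma conj_partK s q : sorted geq s -> (0 < q)%N ->
  part (conj_part (conj_part s)) q = part s q.
Proof.
move=> s_dec q0; have cs := partition_sorted (conj_part_partition s_dec).
have H p : (0 < p)%N ->
    (p <= part (conj_part (conj_part s)) q)%N = (p <= part s q)%N.
  by move=> p0; rewrite !leq_conj_part.
apply/eqP; rewrite eqn_leq; apply/andP; split.
  have [->//|x0] := posnP (part (conj_part (conj_part s)) q).
  by rewrite -H ?leqnn.
have [->//|x0] := posnP (part s q).
by rewrite H ?leqnn.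
Qed.

Lemma mem_cells la p q : is_partition la ->
  ((p, q) \in cells (la, [::])) =
  [&& (0 < q)%N, (0 < p)%N & (p <= part (conj_part la) q)%N].
Proof.
move=> /partition_sorted la_dec; rewrite /cells /=.
have p0 j : part [::] j = 0%N by rewrite /part nth_nil.
apply/allpairsPdep/and3P => [[p' [q' [p'in q'in [-> ->]]]]|[q0 p0' pq]].
  move: p'in q'in; rewrite !mem_iota p0 => p'in q'in.
  by split; rewrite ?leq_conj_part //; lia.
exists p, q; rewrite leq_conj_part // in pq; rewrite !mem_iota p0; split=> //; last by lia.
have [lt|ge] := ltnP p.-1 (size la); first by lia.
by move: pq; rewrite /part nth_default //; lia.
Qed.

End ConjugatePartitions.

Section RectangleRemoval.
Variables N k h : nat.
Hypothesis k_gt0 : (0 < k)%N.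
Let n := (N + k)%N.

(** The last row of column q of the periodic diagram: the rectangle with h rows gives h - N *
    floor((q-1)/k), and d removals shift this d columns left and d rows up. Allowing every integer q
    makes column k + 1 the first column of the next translate. *)
Definition removed_col (d : nat) (q : int) : int :=
  h%:Z - d%:Z - N%:Z * ((q - 1 + d%:Z) %/ k%:Z)%Z.

Lemma removed_col_le d (q : int) : removed_col d (q + 1) <= removed_col d q.
Proof.
rewrite /removed_col lerD2l lerN2 ler_wpM2l //.
by apply: lez_pdiv2r => //; lia.
Qed.

Lemma removed_col_shift d (q : int) : removed_col d.+1 q = removed_col d (q + 1) - 1.
Proof.
rewrite /removed_col (_ : q + 1 - 1 + d%:Z = q - 1 + d.+1%:Z); last by lia.
by lia.
Qed.

Lemma removed_col_period d (q : int) :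
  removed_col d (q + k%:Z) = removed_col d q - N%:Z.
Proof.
rewrite /removed_col (_ : q + k%:Z - 1 + d%:Z = 1 * k%:Z + (q - 1 + d%:Z)); last by lia.
by rewrite divzMDl; lia.
Qed.

Lemma removed_col_mono d (q q' : int) : q <= q' -> removed_col d q' <= removed_col d q.
Proof.
move=> qq'; rewrite /removed_col lerD2l lerN2 ler_wpM2l //.
by apply: lez_pdiv2r => //; lia.
Qed.

Definition has_removed_cols d la : Prop :=
  cylindric n k la /\ forall q, (0 < q <= k)%N ->
    (part (conj_part la) q)%:Z = removed_col d q.

(** The last new column, la'_1 - N - 1, is column k + 1 of the periodic diagram less one cell, just
    as the others are columns 2, ..., k less one cell. So [flat] is a unit diagonal shift, undefined
    exactly when that last column would be negative. *)
Lemma flat_removed d la : has_removed_cols d la ->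
  if 0 <= removed_col d.+1 k
  then exists2 la', flat n k la = Some la' & has_removed_cols d.+1 la'
  else flat n k la = None.
Proof.
move=> [la_cyl la_col].
have nk : (n - k)%N = N by rewrite /n; lia.
have c1 : (part (conj_part la) 1)%:Z = removed_col d 1 by apply: la_col; lia.
have e1 : removed_col d.+1 k = removed_col d 1 - N%:Z - 1.
  by rewrite removed_col_shift (addrC k%:Z) removed_col_period.
case: ifP => h1; rewrite /flat la_cyl nk /=; last by rewrite ifF //; lia.
rewrite ifT; last by lia.
set s := rcons _ _; exists (conj_part s) => //.
have sz : size s = k by rewrite size_rcons size_map size_iota; lia.
have s_part q : (0 < q <= k)%N -> (part s q)%:Z = removed_col d.+1 q.
  move=> qk; rewrite /part /s nth_rcons size_map size_iota.
  have [lt|ge] := ltnP q.-1 (k - 1).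
    rewrite (nth_map 0%N) ?size_iota // nth_iota //.
    have := la_col (2 + q.-1)%N.
    have := removed_col_mono d (_ : (2 + q.-1)%N%:Z <= k%:Z + 1).
    rewrite removed_col_shift in h1; rewrite removed_col_shift.
    have -> : (2 + q.-1)%N%:Z = q%:Z + 1 by lia.
    by lia.
  rewrite ifT; last by lia.
  have -> : q = k by lia.
  by rewrite e1; lia.
have s_dec : sorted geq s.
  apply/(sortedP 0%N) => j; rewrite sz => jk /=.
  have := s_part j.+1; have := s_part j.+2; rewrite /part /=.
  have := removed_col_mono d.+1 (_ : j.+1%:Z <= j.+2%:Z).
  by lia.
split; last by move=> q qk; rewrite conj_partK ?s_part //; lia.
apply/and3P; split; first exact: conj_part_partition.
  by rewrite conj_part_count // -sz count_size.
rewrite nk !conj_partK //; have : (part s 1)%:Z = removed_col d.+1 1 by apply: s_part; lia.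
have := s_part k.
have := removed_col_le d.+1 k.
by rewrite (addrC k%:Z) removed_col_period; lia.
Qed.

Lemma removal_iter_rectangle d :
  if 0 <= removed_col d k
  then exists2 la, removal_iter n k d (nseq h k, [::]) = Some (la, [::]) &
                   has_removed_cols d la
  else removal_iter n k d (nseq h k, [::]) = None.
Proof.
have nk : (n - k)%N = N by rewrite /n; lia.
elim: d => [|d IHd].
  have c0 q : (0 < q <= k)%N -> removed_col 0 q = h%:Z.
    by move=> qk; rewrite /removed_col divz_small; lia.
  rewrite c0 ?k_gt0 ?leqnn //=; exists (nseq h k) => //.
  have sn : sorted geq (nseq h k).
    by case: h => //= j; elim: j => //= j ->; rewrite leqnn.
  have cn q : (0 < q <= k)%N -> part (conj_part (nseq h k)) q = h.
    by move=> qk; rewrite conj_part_count ?count_nseq //=; lia.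
  split; last by move=> q qk; rewrite cn // c0.
  rewrite /cylindric /is_partition sn !cn ?leqnn ?k_gt0 // leq_addr andbT /=.
  rewrite mem_nseq /part nth_nseq; case: ifP => _; lia.
rewrite /removal_iter iterS -/(removal_iter n k d _).
(* Column k loses at least one cell at each removal, so it stays negative once it is negative. *)
have mon : removed_col d.+1 k < removed_col d k.
  by rewrite removed_col_shift; have := removed_col_le d k; lia.
case: ifP IHd => [d0 [la -> la_cols] | d0 ->] /=; last first.
  by rewrite ifF //; lia.
have := flat_removed la_cols; rewrite /removal /=.
by case: ifP => [_ [la' -> la'_cols]|_ ->] //=; exists la'.
Qed.

Lemma removal_iter_cells d la : has_removed_cols d la ->
  forall p q : nat, ((p, q) \in cells (la, [::])) =
    [&& (0 < q)%N, (q <= k)%N, (0 < p)%N & p%:Z <= removed_col d q].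
Proof.
move=> [/and3P[la_part la1 _] la_col] p q; rewrite mem_cells //.
have [q0|] := ltnP 0 q; last by [].
have [p0|] := ltnP 0 p; last by rewrite !andbF.
have [qk|qk] /= := leqP q k; first by rewrite -la_col ?q0 // lez_nat.
apply/negbTE; rewrite leq_conj_part ?partition_sorted // -ltnNge.
apply: leq_ltn_trans qk; apply: leq_trans la1.
have la_dec := partition_sorted la_part.
have [le|gt] := leqP (part la p) (part la 1); first by [].
have := leq_conj_part (q := part la p) la_dec p0.
have := leq_conj_part (p := 1) (q := part la p) la_dec.
lia.
Qed.

End RectangleRemoval.

(** * Height functions *)

Lemma int_le_ind (P : int -> int -> Prop) :
  (forall t, P t t) -> (forall t u : int, t <= u -> P t u -> P t (u + 1)) ->
  forall t u : int, t <= u -> P t u.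
Proof.
move=> P0 PS t u tu; have -> : u = t + `|u - t|%N%:Z by lia.
elim: `|u - t|%N => [|j IHj]; first by rewrite addr0.
have -> : t + j.+1%:Z = t + j%:Z + 1 by lia.
by apply: PS => //; lia.
Qed.

Lemma divz_bounds (k : nat) (x : int) : (0 < k)%N -> exists e f : int,
  [/\ x = e * k%:Z + f, 0 <= f, f < k%:Z & (x %/ k%:Z)%Z = e].
Proof.
move=> k_gt0; exists (x %/ k%:Z)%Z, (x %% k%:Z)%Z; split => //.
- exact: divz_eq.
- by apply: modz_ge0; lia.
- by apply: ltz_pmod; lia.
Qed.

Lemma le_int_inj (x y : int) : (forall p : int, (p <= x) = (p <= y)) -> x = y.
Proof. by move=> xy; have := xy x; have := xy y; lia. Qed.

(** A strictly increasing integer sequence is unbounded in both directions, so its sublevel sets are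
    half-lines. Applied to the diagonals of a tableau, this yields F. *)
Lemma increasing_int_inverse (G : int -> int) (h : int) :
  (forall p : int, G p < G (p + 1)) ->
  exists p : int, forall x : int, (G x <= h) = (x <= p).
Proof.
move=> GS.
have Gle : forall x y : int, x <= y -> G x + (y - x) <= G y.
  by apply: int_le_ind => [t|t u tu]; [lia | have := GS u; lia].
pose x0 : int := - (`|G 0| + `|h|).
have Gx0 : G x0 <= h by have := Gle x0 0; lia.
have [|j hj jmin] := @ex_minnP (fun j => h < G (x0 + j%:Z)).
  by exists (`|h| + `|x0| + `|G x0|).+1%N; have := Gle x0 (x0 + (`|h| + `|x0| + `|G x0|).+1%N); lia.
exists (x0 + j%:Z - 1) => x; have [xx0|xx0] := leP x x0.
  case: j hj {jmin} => [|j] hj; first by move: hj; rewrite addr0; lia.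
  by have := Gle x x0; lia.
have [xj|xj] := ltP x (x0 + j%:Z); last by have := Gle _ _ xj; lia.
have -> : x <= x0 + j%:Z - 1 by lia.
have xE : x = x0 + `|x - x0|%N%:Z by lia.
rewrite xE leNgt; apply/negP => /jmin; lia.
Qed.

(** A bijection given as a relation, so that neither map has to be constructed; the relation used
    below is to share a height function. *)
Lemma sum_correspondence (V : nmodType) (I J : finType) (P : pred I) (Q : pred J)
    (R : I -> J -> Prop) (f : I -> V) (g : J -> V) :
  (forall i, P i -> exists2 j, Q j & R i j) ->
  (forall j, Q j -> exists2 i, P i & R i j) ->
  (forall i j j', P i -> Q j -> Q j' -> R i j -> R i j' -> j = j') ->
  (forall i i' j, P i -> P i' -> Q j -> R i j -> R i' j -> i = i') ->
  (forall i j, P i -> Q j -> R i j -> f i = g j) ->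
  \sum_(i | P i) f i = \sum_(j | Q j) g j.
Proof.
move=> PQ QP R_fun R_inj fg.
transitivity (\sum_(i | P i) \sum_(j | Q j && `[< R i j >]) f i).
  apply: eq_bigr => i Pi; have [j Qj Rij] := PQ i Pi.
  rewrite (big_pred1 j) // => j' /=; apply/andP/eqP => [[Qj' /asboolP Rij']|->].
    exact: R_fun Rij' Rij.
  by split=> //; apply/asboolP.
rewrite (exchange_big_dep Q) /=; last by move=> i j _ /andP[].
apply: eq_bigr => j Qj; have [i Pi Rij] := QP j Qj.
rewrite (big_pred1 i) ?(fg i j) // => i' /=; rewrite Qj /=.
apply/andP/eqP => [[Pi' /asboolP Rij']|->]; first exact: R_inj Rij' Rij.
by split=> //; apply/asboolP.
Qed.

Section HeightFunctions.
Variables N k a b r m : nat.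
Hypotheses (k_gt0 : (0 < k)%N) (a_gt0 : (0 < a)%N) (le_ab : (a <= b)%N).
Hypotheses (le_Nr : (N <= r)%N) (le_rM : (r + N + a <= b.+1)%N) (le_bm : (b <= m)%N).
Let n := (N + k)%N.

(* N = i - 1 paths run through each period of n = N + k units of time, and a   *)
(* chain is made of sets of r elements.  [F h t] is the largest label of a     *)
(* path at height at most h at time t, path p being the one that reaches       *)
(* height a - 1 at time n + p for p in [1, N].                                 *)
Record height_function (F : int -> int -> int) : Prop := HeightFunction {
  hf_period : forall h t : int, a%:Z - 1 <= h <= b%:Z -> F h (t + n%:Z) = F h t + N%:Z;
  hf_bottom : forall t : int, 0 <= t <= n%:Z ->
    F (a%:Z - 1) t = if t <= N%:Z then t - N%:Z else 0;
  hf_top : forall t : int, 0 <= t <= n%:Z ->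
    F b%:Z t = if t <= k%:Z then r%:Z else r%:Z + t - k%:Z;
  hf_diag : forall h t : int, a%:Z <= h <= b%:Z -> F (h - 1) (t + 1) <= F h t;
  hf_step : forall h t : int, a%:Z - 1 <= h <= b%:Z -> F h t <= F h (t + 1);
  hf_up : forall h t : int, a%:Z <= h <= b%:Z -> F h t <= F (h - 1) t + 1 }.

(* Last rows of the columns of the periodic diagrams of the empty partition    *)
(* and of the d-fold removal, where d = b - a + 1 - N - r.                     *)
Definition bottom_col (q : int) : int := - (N%:Z * ((q - 1) %/ k%:Z)%Z).
Definition top_col (q : int) : int :=
  r%:Z - N%:Z * ((q - 1 + (b.+1 - a - N - r)%N%:Z) %/ k%:Z)%Z.

Section HeightFunctionTheory.
Variable F : int -> int -> int.
Hypothesis hF : height_function F.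

Lemma hf_step_le1 (h t : int) : a%:Z - 1 <= h <= b%:Z -> F h (t + 1) <= F h t + 1.
Proof.
move=> hab; have [ha|ha] := leP a%:Z h.
  have := hf_diag hF (h := h) t; have := hf_up hF (h := h) (t + 1); lia.
(* On the lowest line [hf_diag] and [hf_up] are applied at height a instead. *)
have -> : h = a%:Z - 1 by lia.
have := hf_diag hF (h := a) t; have := hf_up hF (h := a) t; lia.
Qed.

Lemma hf_time (h t u : int) : a%:Z - 1 <= h <= b%:Z -> t <= u ->
  F h t <= F h u <= F h t + (u - t).
Proof.
move=> hab; move: t u; apply: int_le_ind => [t|t u tu]; first by lia.
have := hf_step hF u hab; have := hf_step_le1 u hab; lia.
Qed.

Lemma hf_shear (h h' s : int) : a%:Z - 1 <= h -> h <= h' -> h' <= b%:Z ->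
  F h (s - h) <= F h' (s - h').
Proof.
move=> ha hh'; move: h h' hh' ha; apply: int_le_ind => [//|h h' hh' IH ha hb].
have := IH ha; have := hf_diag hF (h := h' + 1) (s - (h' + 1)).
have -> : h' + 1 - 1 = h' by lia.
have -> : s - (h' + 1) + 1 = s - h' by lia.
lia.
Qed.

Lemma hf_height (h h' t : int) : a%:Z - 1 <= h -> h <= h' -> h' <= b%:Z ->
  F h' t <= F h t + (h' - h).
Proof.
move=> ha hh'; move: h h' hh' ha; apply: int_le_ind => [|h h' hh' IH ha hb].
  by move=> *; lia.
have := IH ha; have := hf_up hF (h := h' + 1) t.
have -> : h' + 1 - 1 = h' by lia.
lia.
Qed.

Lemma hf_periods (h t w : int) : a%:Z - 1 <= h <= b%:Z ->
  F h (t + w * n%:Z) = F h t + w * N%:Z.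
Proof.
move=> hab.
have pos (j : nat) u : F h (u + j%:Z * n%:Z) = F h u + j%:Z * N%:Z.
  elim: j => [|j IHj]; first by rewrite !mul0r !addr0.
  rewrite (_ : u + j.+1%:Z * n%:Z = u + j%:Z * n%:Z + n%:Z); last by lia.
  by rewrite hf_period // IHj; lia.
case: w => j; first exact: pos.
have := pos j.+1 (t + Negz j * n%:Z).
have -> : t + Negz j * n%:Z + j.+1%:Z * n%:Z = t by lia.
by lia.
Qed.

(** With f = (q - 1) mod k, the function F (a-1) vanishes at both times n - 1 - f and n - f, and its
    slope lies between 0 and 1 ([hf_time]). This locates exactly where it falls below the diagonal.
    [hf_top_col] is the same argument with the value r of F b at k - 1 - f and k - f. *)
Lemma hf_bottom_col (p q : int) :
  (p <= F (a%:Z - 1) (n%:Z - q + p)) = (p <= bottom_col q).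
Proof.
rewrite /bottom_col; have [e [f [qE f0 fk ->]]] := divz_bounds (q - 1) k_gt0.
have -> : n%:Z - q + p = n%:Z - 1 - f + (p + N%:Z * e) + (- e) * n%:Z by lia.
have ha : a%:Z - 1 <= a%:Z - 1 <= b%:Z by lia.
rewrite hf_periods //.
set p' := p + N%:Z * e.
have b0 := hf_bottom hF (t := n%:Z - 1 - f); have b1 := hf_bottom hF (t := n%:Z - f).
have [p'0|p'0] := leP p' 0.
  have := hf_time (h := a%:Z - 1) (t := n%:Z - 1 - f + p') (u := n%:Z - 1 - f) ha.
  by move: b0 b1; case: ifP; case: ifP; lia.
have := hf_time (h := a%:Z - 1) (u := n%:Z - 1 - f + p') (t := n%:Z - f) ha.
by move: b0 b1; case: ifP; case: ifP; lia.
Qed.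

Lemma hf_top_col (p q : int) :
  (p <= F b%:Z (n%:Z + a%:Z - 1 - q + p - b%:Z)) = (p <= top_col q).
Proof.
rewrite /top_col; set d := (b.+1 - a - N - r)%N.
have [e [f [qE f0 fk ->]]] := divz_bounds (q - 1 + d%:Z) k_gt0.
have -> : n%:Z + a%:Z - 1 - q + p - b%:Z =
   k%:Z - 1 - f + (p + N%:Z * e - r%:Z) + (- e) * n%:Z by lia.
have ha : a%:Z - 1 <= b%:Z <= b%:Z by lia.
rewrite hf_periods //.
set p' := p + N%:Z * e - r%:Z.
have b0 := hf_top hF (t := k%:Z - 1 - f); have b1 := hf_top hF (t := k%:Z - f).
have [p'0|p'0] := leP p' 0.
  have := hf_time (h := b%:Z) (t := k%:Z - 1 - f + p') (u := k%:Z - 1 - f) ha.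
  by move: b0 b1; case: ifP; case: ifP; lia.
have := hf_time (h := b%:Z) (u := k%:Z - 1 - f + p') (t := k%:Z - f) ha.
by move: b0 b1; case: ifP; case: ifP; lia.
Qed.

End HeightFunctionTheory.

(** * Height functions and cylindric tableaux *)

Section Tableaux.
Variable s : skew_shape.
Hypothesis cellsE : forall p q : nat, ((p, q) \in cells s) =
  [&& (0 < q)%N, (q <= k)%N, (0 < p)%N & p%:Z <= top_col q].

Notation topc := top_col.
Notation botc := bottom_col.

(** The common value of height plus time for the stay recorded by c; it is the content shifted by n
    + a - 1, hence the superscript of the weight of c. *)
Definition diagonal (c : nat * nat) : int :=
  n%:Z + a%:Z - 1 - c.2%:Z + c.1%:Z.

(** The entry of a cell in row p is the first height at which F reaches p along its diagonal. *)
Definition tableau_heights (F : int -> int -> int) (T : filling m s) : Prop :=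
  forall (c : seq_sub (cells s)) (h : int), a%:Z - 1 <= h <= b%:Z ->
    ((T c).+1%:Z <= h) = ((val c).1%:Z <= F h (diagonal (val c) - h)).

Definition letters_in (T : filling m s) : bool :=
  [forall c, (a <= (T c).+1 <= b)%N].

Lemma botc_base (q : int) : 1 <= q <= k%:Z -> botc q = 0.
Proof.
move=> qk; rewrite /bottom_col.
have [e [f [qE f0 fk ->]]] := divz_bounds (q - 1) k_gt0.
have -> : e = 0 by nia.
by rewrite mulr0 oppr0.
Qed.

Lemma topc_period (q e : int) : topc (q + e * k%:Z) = topc q - e * N%:Z.
Proof.
rewrite /top_col; set d := (_ - r)%N.
have -> : q + e * k%:Z - 1 + d%:Z = e * k%:Z + (q - 1 + d%:Z) by lia.
by rewrite divzMDl; lia.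
Qed.

Lemma topc_mono (q : int) : topc (q + 1) <= topc q.
Proof.
rewrite /top_col; set d := (_ - r)%N.
have [e [f [qE f0 fk ->]]] := divz_bounds (q - 1 + d%:Z) k_gt0.
have [e' [f' [qE' f0' fk' ->]]] := divz_bounds (q + 1 - 1 + d%:Z) k_gt0.
have : e <= e' by nia.
nia.
Qed.

Lemma cell_bounds (c : seq_sub (cells s)) :
  [&& (0 < (val c).2)%N, ((val c).2 <= k)%N, (0 < (val c).1)%N &
      (val c).1%:Z <= topc (val c).2].
Proof. by rewrite -cellsE -surjective_pairing; exact: valP. Qed.

Section HeightsToTableau.
Variable F : int -> int -> int.
Hypothesis hF : height_function F.

(** F increases along the diagonal of a cell in row p ([hf_shear]); it is below p at height a - 1 by
    the lower rim and at least p at height b by the upper one. *)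
Lemma tableau_of_heights : exists T, tableau_heights F T.
Proof.
have ex (c : seq_sub (cells s)) : exists v : 'I_m, forall h : int,
    a%:Z - 1 <= h <= b%:Z ->
    (v.+1%:Z <= h) = ((val c).1%:Z <= F h (diagonal (val c) - h)).
  have /and4P[q0 qk p0 pt] := cell_bounds c.
  set p : nat := (val c).1 in p0 pt *; set q : nat := (val c).2 in q0 qk pt *.
  set D : int := diagonal (val c).
  have hb : p%:Z <= F b (D - b%:Z).
    have := hf_top_col hF p q.
    by rewrite /D /diagonal -/p -/q pt => ->.
  have ha : F (a%:Z - 1) (D - (a%:Z - 1)) < p%:Z.
    have := hf_bottom_col hF p q.
    rewrite botc_base; last by lia.
    rewrite /D /diagonal -/p -/q.
    have -> : n%:Z + a%:Z - 1 - q%:Z + p%:Z - (a%:Z - 1) = n%:Z - q%:Z + p%:Z by lia.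
    by lia.
  have [|v hv vmin] := @ex_minnP (fun v => (a <= v <= b)%N && (p%:Z <= F v (D - v%:Z))).
    by exists b; rewrite le_ab leqnn.
  have vm : (v.-1 < m)%N by lia.
  exists (Ordinal vm) => h hab; rewrite -/D -/p /=.
  have -> : v.-1.+1 = v by lia.
  apply/idP/idP => [vh|hh].
    have /andP[/andP[av vb] pv] := hv.
    have := hf_shear hF (h := v) (h' := h) D; lia.
  have ah : a%:Z <= h.
    rewrite leNgt; apply/negP => ha'.
    have hE : h = a%:Z - 1 by lia.
    by move: hh; rewrite hE; lia.
  have := vmin `|h|%N; have -> : `|h|%N%:Z = h by lia.
  by rewrite hh; lia.
have [T hT] := choice ex.
by exists [ffun c => T c] => c h hab; rewrite ffunE hT.
Qed.

Variable T : filling m s.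
Hypothesis hT : tableau_heights F T.

Lemma tableau_heights_letters c : (a <= (T c).+1 <= b)%N.
Proof.
have /and4P[q0 qk p0 pt] := cell_bounds c.
set p : nat := (val c).1 in p0 pt *; set q : nat := (val c).2 in q0 qk pt *.
have hb := hf_top_col hF p q.
have ha := hf_bottom_col hF p q.
have hTb := hT c (h := b); have hTa := hT c (h := a%:Z - 1).
rewrite /diagonal -/p -/q in hTa hTb.
have E : n%:Z + a%:Z - 1 - q%:Z + p%:Z - (a%:Z - 1) = n%:Z - q%:Z + p%:Z by lia.
rewrite E in hTa; rewrite botc_base in ha; last by lia.
lia.
Qed.

(** Translating a cell by t shifts its diagonal by - t n and F by - t N. Row order then follows from
    monotonicity in time, and column order from that together with one use of [hf_up]. *)
Lemma tableau_heights_cylindric : cylindric_tableau n k T.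
Proof.
have nk : (n - k)%N = N by rewrite /n; lia.
have nE : n%:Z = N%:Z + k%:Z by rewrite /n; lia.
split=> c c' t t'; rewrite /translate nk;
  have := hT c; have := hT c'; have := tableau_heights_letters c';
  rewrite /diagonal;
  set p : nat := (val c).1; set q : nat := (val c).2;
  set p' : nat := (val c').1; set q' : nat := (val c').2;
  set v : nat := T c; set v' : nat := T c'; move=> lc' hc' hc /= e1 e2;
  clearbody p q p' q' v v';
  (have tn : t * n%:Z = t * N%:Z + t * k%:Z by rewrite nE mulrDr);
  (have tn' : t' * n%:Z = t' * N%:Z + t' * k%:Z by rewrite nE mulrDr); clear nk nE; clearbody n.
  have hab : a%:Z - 1 <= v'.+1%:Z <= b%:Z by lia.
  have := hc _ hab; have := hc' _ hab; rewrite lexx lez_nat ltnS => /esym h' ->.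
  have := hf_periods hF (n%:Z + a%:Z - 1 - q%:Z + p%:Z - v'.+1%:Z) (- t) hab.
  have := hf_periods hF (n%:Z + a%:Z - 1 - q'%:Z + p'%:Z - v'.+1%:Z) (- t') hab.
  have := hf_time hF (t := n%:Z + a%:Z - 1 - q'%:Z + p'%:Z - v'.+1%:Z + - t' * n%:Z)
          (u := n%:Z + a%:Z - 1 - q%:Z + p%:Z - v'.+1%:Z + - t * n%:Z) hab.
  move=> H1 H2 H3; rewrite H2 H3 in H1; have H4 := H1 _; lia.
have hab : a%:Z - 1 <= v'.+1%:Z <= b%:Z by lia.
have hab' : a%:Z - 1 <= v'%:Z <= b%:Z by lia.
have := hc _ hab'; have := hc' _ hab; rewrite lexx lez_nat => /esym h' ->.
have := hf_periods hF (n%:Z + a%:Z - 1 - q%:Z + p%:Z - v'%:Z) (- t) hab'.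
have := hf_periods hF (n%:Z + a%:Z - 1 - q'%:Z + p'%:Z - v'.+1%:Z) (- t') hab.
have := hf_time hF (u := n%:Z + a%:Z - 1 - q'%:Z + p'%:Z - v'.+1%:Z + - t' * n%:Z)
        (t := n%:Z + a%:Z - 1 - q%:Z + p%:Z - v'%:Z + - t * n%:Z) hab.
have := hf_up hF (h := v'.+1) (n%:Z + a%:Z - 1 - q%:Z + p%:Z - v'%:Z + - t * n%:Z).
have -> : v'.+1%:Z - 1 = v'%:Z by lia.
move=> H1 H2 H3 H4; rewrite H3 in H2; rewrite H4 in H1; have H5 := H2 _; lia.
Qed.

End HeightsToTableau.

Lemma tableau_heights_inj_tableau F T T' : height_function F ->
  tableau_heights F T -> tableau_heights F T' -> T = T'.
Proof.
move=> hF hT hT'; apply/ffunP => c; apply: val_inj => /=.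
have := tableau_heights_letters hF hT c.
have := tableau_heights_letters hF hT' c.
have := hT c; have := hT' c; set v : nat := T c; set v' : nat := T' c.
clearbody v v' => h' h lT' lT.
have := h v.+1; have := h' v.+1; have := h v'.+1; have := h' v'.+1.
lia.
Qed.

Lemma tableau_heights_inj_heights F F' T :
  height_function F -> height_function F' ->
  tableau_heights F T -> tableau_heights F' T ->
  forall h t : int, a%:Z - 1 <= h <= b%:Z -> F h t = F' h t.
Proof.
move=> hF hF' hT hT' h t hab; apply: le_int_inj => p.
(* The point (h, t) and the row p belong to column n + a - 1 + p - h - t; translation by e periods
   brings it to f + 1 in [1, k]. There p is decided by the bottom rim, by the top rim, or by an
   entry of T. *)
have [e [f [qE f0 fk _]]] := divz_bounds (n%:Z + a%:Z - 1 + p - h - t - 1) k_gt0.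

have P := hf_periods hF t e hab; have P' := hf_periods hF' t e hab.
suff : (p + e * N%:Z <= F h (t + e * n%:Z)) = (p + e * N%:Z <= F' h (t + e * n%:Z)).
  by rewrite P P'; lia.
have tE : t + e * n%:Z = n%:Z + a%:Z - 1 - (f + 1) + (p + e * N%:Z) - h by lia.
rewrite tE; set p' : int := p + e * N%:Z.
have fb : botc (f + 1) = 0 by apply: botc_base; lia.
have ra : a%:Z - 1 <= a%:Z - 1 by [].
have [p0|p0] := leP p' 0.
  have aux G : height_function G ->
      p' <= G h (n%:Z + a%:Z - 1 - (f + 1) + p' - h).
    move=> hG; have := hf_bottom_col hG p' (f + 1).
    have := hf_shear hG (h := a%:Z - 1) (h' := h) (n%:Z + a%:Z - 1 - (f + 1) + p').
    have -> : n%:Z + a%:Z - 1 - (f + 1) + p' - (a%:Z - 1) = n%:Z - (f + 1) + p' by lia.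
    by rewrite fb; lia.
  by rewrite !aux.
have [pt|pt] := leP p' (topc (f + 1)); last first.
  have aux G : height_function G ->
      G h (n%:Z + a%:Z - 1 - (f + 1) + p' - h) < p'.
    move=> hG; have := hf_top_col hG p' (f + 1).
    have := hf_shear hG (h := h) (h' := b) (n%:Z + a%:Z - 1 - (f + 1) + p').
    by lia.
  by rewrite !leNgt !aux.
have pE : p' = `|p'|%N%:Z by lia.
have fE : f + 1 = `|(f + 1)%R|%N%:Z by lia.
have cin : (`|p'|%N, `|(f + 1)%R|%N) \in cells s.
  by rewrite cellsE -pE -fE pt; lia.
have := hT (SeqSub cin) h hab; have := hT' (SeqSub cin) h hab.
rewrite /diagonal /= -pE -fE => <- <- //.
Qed.

Section TableauToHeights.
Hypothesis topk : 0 <= topc k.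
Variable T : filling m s.
Hypothesis T_cyl : cylindric_tableau n k T.
Hypothesis T_ab : letters_in T.

Let entry (p q : nat) : int :=
  if insub (p, q) is Some c then (T c).+1%:Z else 0.

(** Upwards the column continues with a - 1, a - 2, ..., downwards with b + 1, b + 2, .... For 1 <=
    q <= k the last branch always meets a cell, so the default value of [entry] is not reached. *)
Let column (p q : int) : int :=
  if p <= 0 then a%:Z - 1 + p
  else if topc q < p then b%:Z + (p - topc q) else entry `|p| `|q|.

(* The filling of the infinite shape, continued above and below it so that    *)
(* rows still increase weakly and columns strictly.                           *)
Let ext (p q : int) : int :=
  let e := ((q - 1) %/ k%:Z)%Z in column (p + e * N%:Z) (q - e * k%:Z).

(** Keeps the upper and lower continuations in [column] from overlapping. *)
Lemma topc_ge0 (q : int) : q <= k%:Z -> 0 <= topc q.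
Proof.
have H : forall t u : int, t <= u -> topc u <= topc t.
  by apply: int_le_ind => [//|t u tu]; have := topc_mono u; lia.
by move/H; lia.
Qed.

Lemma entryE (c : seq_sub (cells s)) p q : val c = (p, q) ->
  entry p q = (T c).+1%:Z.
Proof.
by move=> cE; rewrite /entry -cE valK.
Qed.

Lemma cell_ex (p q : int) : 1 <= q <= k%:Z -> 0 < p -> p <= topc q ->
  exists c : seq_sub (cells s),
  [/\ val c = (`|p|%N, `|q|%N), column p q = (T c).+1%:Z & a%:Z <= (T c).+1%:Z <= b%:Z].
Proof.
move=> qk p0 pt.
have pE : p = `|p|%N%:Z by lia.
have qE : q = `|q|%N%:Z by lia.
have cin : (`|p|%N, `|q|%N) \in cells s by rewrite cellsE -pE -qE pt; lia.
exists (SeqSub cin); split=> //; last by have /forallP/(_ (SeqSub cin)) := T_ab; lia.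
rewrite /column; case: ifP; first by lia.
case: ifP; first by lia.
by move=> _ _; apply: entryE.
Qed.

Lemma column_low (p q : int) : p <= 0 -> column p q = a%:Z - 1 + p.
Proof. by rewrite /column => ->. Qed.

Lemma column_high (p q : int) : q <= k%:Z -> topc q < p ->
  column p q = b%:Z + (p - topc q).
Proof.
move=> qk tp; have := topc_ge0 qk => t0.
by rewrite /column tp; case: ifP => //; lia.
Qed.

Lemma column_row (p q : int) : 1 <= q -> q + 1 <= k%:Z ->
  column p q <= column p (q + 1).
Proof.
move=> q1 qk; have tm := topc_mono q.
have [p0|p0] := leP p 0; first by rewrite !column_low.
have [pt|pt] := leP p (topc q); last by rewrite !column_high; lia.
have [|c [cE -> cb]] := cell_ex (p := p) (q := q) _ p0 pt; first by lia.
have [pt'|pt'] := leP p (topc (q + 1)); last by rewrite column_high; lia.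
have [|c' [cE' -> cb']] := cell_ex (p := p) (q := q + 1) _ p0 pt'; first by lia.
have := T_cyl.1 c c' 0 0; rewrite /translate cE cE' /=; lia.
Qed.

(** The right neighbour of column k is column 1 of the next translate, which lies N rows higher, so
    row p continues in its row p + N. *)
Lemma column_wrap (p : int) : column p k <= column (p + N%:Z) 1.
Proof.
have tm : topc 1 - N%:Z <= topc k.
  by have := topc_mono k; have := topc_period 1 1; rewrite mul1r addrC => ->; lia.
have t0 : 0 <= topc 1 by apply: topc_ge0; lia.
have [p0|p0] := leP p 0.
  rewrite column_low //; have [pN|pN] := leP (p + N%:Z) 0.
    by rewrite column_low //; lia.
  have [pt'|pt'] := leP (p + N%:Z) (topc 1); last by rewrite column_high; lia.
  by have [|c' [cE' -> cb']] := cell_ex (p := p + N%:Z) (q := 1) _ pN pt'; lia.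
have [pt|pt] := leP p (topc k); last by rewrite !column_high; lia.
have [|c [cE -> cb]] := cell_ex (p := p) (q := k) _ p0 pt; first by lia.
have [pt'|pt'] := leP (p + N%:Z) (topc 1); last by rewrite column_high; lia.
have [||c' [cE' -> cb']] := cell_ex (p := p + N%:Z) (q := 1) _ _ pt'; try lia.
have := T_cyl.1 c c' 0 1; rewrite /translate cE cE' /=.
have -> : (n - k)%N = N by rewrite /n; lia.
lia.
Qed.

Lemma column_strict (p q : int) : 1 <= q <= k%:Z ->
  column p q < column (p + 1) q.
Proof.
move=> qk; have t0 : 0 <= topc q by apply: topc_ge0; lia.
have [p0|p0] := leP p 0.
  rewrite column_low //; have [pN|pN] := leP (p + 1) 0.
    by rewrite column_low //; lia.
  have [pt'|pt'] := leP (p + 1) (topc q); last by rewrite column_high; lia.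
  by have [|c' [cE' -> cb']] := cell_ex (p := p + 1) (q := q) _ pN pt'; lia.
have [pt|pt] := leP p (topc q); last by rewrite !column_high; lia.
have [|c [cE -> cb]] := cell_ex (p := p) (q := q) _ p0 pt; first by lia.
have [pt'|pt'] := leP (p + 1) (topc q); last by rewrite column_high; lia.
have [||c' [cE' -> cb']] := cell_ex (p := p + 1) (q := q) _ _ pt'; try lia.
have := T_cyl.2 c c' 0 0; rewrite /translate cE cE' /=; lia.
Qed.

Lemma ext_base (p q e : int) : 1 <= q <= k%:Z ->
  ext (p - e * N%:Z) (q + e * k%:Z) = column p q.
Proof.
move=> qk; rewrite /ext.
have [e' [f [qE f0 fk ->]]] := divz_bounds (q + e * k%:Z - 1) k_gt0.
have -> : e' = e by nia.
by congr column; lia.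
Qed.

Lemma ext_ex (p q : int) : exists p' q' e : int,
  [/\ 1 <= q' <= k%:Z, p = p' - e * N%:Z, q = q' + e * k%:Z & ext p q = column p' q'].
Proof.
have [e [f [qE f0 fk _]]] := divz_bounds (q - 1) k_gt0.
exists (p + e * N%:Z), (f + 1), e; split; try lia.
by rewrite -(ext_base _ e); [congr ext; lia | lia].
Qed.

Lemma ext_row (p q : int) : ext p q <= ext p (q + 1).
Proof.
have [p' [q' [e [q'k -> -> ->]]]] := ext_ex p q.
have [lt|ge] := ltP q' k.
  rewrite (_ : q' + e * k%:Z + 1 = q' + 1 + e * k%:Z); last by lia.
  by rewrite ext_base; [apply: column_row; lia | lia].
have -> : q' = k by lia.
rewrite (_ : k%:Z + e * k%:Z + 1 = 1 + (e + 1) * k%:Z); last by lia.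
rewrite (_ : p' - e * N%:Z = p' + N%:Z - (e + 1) * N%:Z); last by lia.
by rewrite ext_base; [exact: column_wrap | lia].
Qed.

Lemma ext_strict (p q : int) : ext p q < ext (p + 1) q.
Proof.
have [p' [q' [e [q'k -> -> ->]]]] := ext_ex p q.
rewrite (_ : p' - e * N%:Z + 1 = p' + 1 - e * N%:Z); last by lia.
by rewrite ext_base //; apply: column_strict.
Qed.

Lemma ext_period (p q : int) : ext (p - N%:Z) (q + k%:Z) = ext p q.
Proof.
have [p' [q' [e [q'k -> -> ->]]]] := ext_ex p q.
rewrite (_ : p' - e * N%:Z - N%:Z = p' - (e + 1) * N%:Z); last by lia.
rewrite (_ : q' + e * k%:Z + k%:Z = q' + (e + 1) * k%:Z); last by lia.
by rewrite ext_base.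
Qed.

Lemma ext_bottom (p q : int) : (ext p q <= a%:Z - 1) = (p <= botc q).
Proof.
have [p' [q' [e [q'k -> -> ->]]]] := ext_ex p q.
have -> : botc (q' + e * k%:Z) = - (N%:Z * e).
  rewrite /bottom_col.
  have [e' [f [qE f0 fk ->]]] := divz_bounds (q' + e * k%:Z - 1) k_gt0.
  by have -> : e' = e by nia.
have [p0|p0] := leP p' 0; first by rewrite column_low //; lia.
have [pt|pt] := leP p' (topc q'); last by rewrite column_high; lia.
by have [|c [cE -> cb]] := cell_ex (p := p') (q := q') _ p0 pt; lia.
Qed.

Lemma ext_top (p q : int) : (ext p q <= b%:Z) = (p <= topc q).
Proof.
have [p' [q' [e [q'k -> -> ->]]]] := ext_ex p q.
rewrite topc_period; have t0 : 0 <= topc q' by apply: topc_ge0; lia.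
have [p0|p0] := leP p' 0; first by rewrite column_low //; lia.
have [pt|pt] := leP p' (topc q'); last by rewrite column_high; lia.
by have [|c [cE -> cb]] := cell_ex (p := p') (q := q') _ p0 pt; lia.
Qed.

Lemma divk_0 (x : int) : 0 <= x -> x < k%:Z -> (x %/ k%:Z)%Z = 0.
Proof. by move=> x0 xk; have [e [f [qE f0 fk ->]]] := divz_bounds x k_gt0; nia. Qed.

Lemma divk_N1 (x : int) : - k%:Z <= x -> x < 0 -> (x %/ k%:Z)%Z = -1.
Proof. by move=> x0 xk; have [e [f [qE f0 fk ->]]] := divz_bounds x k_gt0; nia. Qed.

Lemma divk_1 (x : int) : k%:Z <= x -> x < k%:Z + k%:Z -> (x %/ k%:Z)%Z = 1.
Proof. by move=> x0 xk; have [e [f [qE f0 fk ->]]] := divz_bounds x k_gt0; nia. Qed.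

(** The cells (p, n + a - 1 - h - t + p) run down a diagonal, on which [ext] is strictly increasing;
    F h t is the last p whose value is at most h. *)
Lemma heights_of_tableau :
  exists F, height_function F /\ tableau_heights F T.
Proof.
have ex (ht : int * int) : exists v : int, forall p : int,
    (ext p (n%:Z + a%:Z - 1 - ht.1 - ht.2 + p) <= ht.1) = (p <= v).
  apply: increasing_int_inverse => p; set x : int := n%:Z + a%:Z - 1 - ht.1 - ht.2.
  have -> : x + (p + 1) = x + p + 1 by lia.
  by have := ext_strict p (x + p); have := ext_row (p + 1) (x + p); lia.
have [F' hF'] := choice ex; pose F h t := F' (h, t).
have hF p h t : (p <= F h t) = (ext p (n%:Z + a%:Z - 1 - h - t + p) <= h).
  by rewrite -(hF' (h, t)).
exists F; split; last first.
  move=> c h hab; have /and4P[q0 qk p0 pt] := cell_bounds c.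
  rewrite hF /diagonal.
  set p : nat := (val c).1 in p0 pt *; set q : nat := (val c).2 in q0 qk pt *.
  have -> : n%:Z + a%:Z - 1 - h - (n%:Z + a%:Z - 1 - q%:Z + p%:Z - h) + p%:Z =
     q%:Z + 0 * k%:Z by lia.
  rewrite (_ : p%:Z = p%:Z - 0 * N%:Z); last by lia.
  rewrite ext_base; last by lia.
  have [|||c' [cE -> _]] := cell_ex (p := p) (q := q); try lia.
  by have -> : c' = c by apply: val_inj; rewrite cE !absz_nat -surjective_pairing.
have max_of (h t v : int) : v <= F h t -> ~~ (v + 1 <= F h t) -> F h t = v by lia.
split=> [h t hab|t t0n|t t0n|h t hab|h t hab|h t hab].
- apply: le_int_inj => p.
  have -> : (p <= F h t + N%:Z) = (p - N%:Z <= F h t) by lia.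
  rewrite !hF -ext_period; congr (ext _ _ <= _); lia.
- case: ifP => tN; apply: max_of; rewrite hF ext_bottom /bottom_col.
  + by rewrite divk_0; lia.
  + by rewrite divk_1; lia.
  + have [tn|tn] := ltP t n; first by rewrite divk_0; lia.
    by rewrite divk_N1; lia.
  + by rewrite divk_0; lia.
- case: ifP => tk; apply: max_of; rewrite hF ext_top /top_col.
  + have [tn|tn] := ltP t k; first by rewrite divk_0; lia.
    by rewrite divk_N1; lia.
  + have [t0|t0] := ltP 0 t; first by rewrite divk_0; lia.
    by rewrite divk_1; lia.
  + by rewrite divk_N1; lia.
  + by rewrite divk_0; lia.
- rewrite hF; have := hF (F (h - 1) (t + 1)) (h - 1) (t + 1); rewrite lexx.
  have -> : n%:Z + a%:Z - 1 - (h - 1) - (t + 1) + F (h - 1) (t + 1) =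
    n%:Z + a%:Z - 1 - h - t + F (h - 1) (t + 1) by lia.
  by lia.
- rewrite hF; have := hF (F h t) h t; rewrite lexx.
  have := ext_row (F h t) (n%:Z + a%:Z - 1 - h - (t + 1) + F h t).
  have -> : n%:Z + a%:Z - 1 - h - (t + 1) + F h t + 1 =
    n%:Z + a%:Z - 1 - h - t + F h t by lia.
  by lia.
- have := hF (F h t) h t; rewrite lexx; have := hF (F h t - 1) (h - 1) t.
  have := ext_strict (F h t - 1) (n%:Z + a%:Z - 1 - h - t + F h t).
  have -> : n%:Z + a%:Z - 1 - (h - 1) - t + (F h t - 1) =
    n%:Z + a%:Z - 1 - h - t + F h t by lia.
  rewrite subrK; lia.
Qed.

End TableauToHeights.

End Tableaux.

(** * Height functions and chains of sets *)

Section SetChains.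
Implicit Types (f : {ffun 'I_n.+1 -> {set 'I_m}}) (X : {set 'I_m}).

Lemma cnt_mono (A : {set 'I_m}) h h' : (h <= h')%N -> (cnt A h <= cnt A h')%N.
Proof.
move=> hh'; apply: subset_leq_card; apply/subsetP => x; rewrite !inE.
by case/andP => -> /= xh; apply: leq_trans hh'.
Qed.

Lemma cnt_segment c e h : (0 < c)%N -> (h <= m)%N ->
  cnt (segment m c e) h = ((minn h e).+1 - c)%N.
Proof.
move=> c0; elim: h => [|h IHh] hm; first by rewrite cnt0 min0n; lia.
by rewrite -[h.+1]/((Ordinal hm).+1) cntS /= IHh ?(ltnW hm) // inE /=; lia.
Qed.

Lemma cntU (A B : {set 'I_m}) h : [disjoint A & B] ->
  cnt (A :|: B) h = (cnt A h + cnt B h)%N.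
Proof.
move=> dAB; have E : [set x in A :|: B | (x < h)%N] =
    [set x in A | (x < h)%N] :|: [set x in B | (x < h)%N].
  by apply/setP => x; rewrite !inE andb_orl.
rewrite /cnt E cardsU (_ : _ :&: _ = set0) ?cards0 ?subn0 //.
apply/setP => x; rewrite !inE; case: (boolP (x \in A)) => //= xA.
by rewrite (disjointFr dAB xA) andbF.
Qed.

Lemma cnt_inj (A B : {set 'I_m}) : (forall h, (h <= m)%N -> cnt A h = cnt B h) -> A = B.
Proof.
move=> AB; apply/setP => x; have := AB x.+1 (ltn_ord x).
by rewrite !cntS (AB x (ltnW (ltn_ord x))) => /addnI; case: (x \in A); case: (x \in B).
Qed.

(* Corrects a height function for the paths outside the window of the chain:  *)
(* those that already ended at the bottom, those that have not started yet.   *)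
Definition outside (h t : int) : int :=
  (if h + t < a%:Z - 1 + N%:Z then h + t - (a%:Z - 1 + N%:Z) else 0) +
  (if b%:Z + k%:Z < h + t then h + t - (b%:Z + k%:Z) else 0).

Definition set_chain X f : Prop :=
  [/\ X \subset segment m (a + N) (b - N), #|X| = (r - N)%N,
      f ord0 = X :|: segment m (b - N).+1 b,
      f ord_max = segment m a (a + N - 1) :|: X &
      forall j, (j < n)%N -> interlaced (f (inord j)) (f (inord j.+1))].

Definition chain_heights (F : int -> int -> int) f : Prop :=
  forall h t : nat, (a <= h.+1)%N -> (h <= b)%N -> (t <= n)%N ->
  (cnt (f (inord t)) h)%:Z = F h t - outside h t.

Section ChainToHeights.
Variables (X : {set 'I_m}) (f : {ffun 'I_n.+1 -> {set 'I_m}}).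
Hypothesis fX : set_chain X f.
Let s t h := cnt (f (inord t)) h.

Lemma cnt_X_low h : (h < a + N)%N -> cnt X h = 0%N.
Proof.
move=> h_lt; have [/subsetP XS _ _ _ _] := fX.
apply/eqP; rewrite cards_eq0; apply/eqP/setP => x; rewrite !inE.
by apply/negP => /andP[/XS]; rewrite inE; lia.
Qed.

Lemma cnt_X_high h : (b - N <= h)%N -> cnt X h = (r - N)%N.
Proof.
move=> h_ge; have [/subsetP XS <- _ _ _] := fX.
congr #|pred_of_set _|; apply/setP => x; rewrite !inE.
by case: (boolP (x \in X)) => //= /XS; rewrite inE; lia.
Qed.

Lemma chain_first h : (h <= m)%N ->
  s 0 h = (cnt X h + ((minn h b).+1 - (b - N).+1))%N.
Proof.
move=> hm; have [/subsetP XS _ f0 _ _] := fX.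
rewrite /s (_ : inord 0 = ord0); last by apply: val_inj; rewrite /= inordK.
rewrite f0 cntU ?cnt_segment //.
by rewrite disjoint_subset; apply/subsetP => x /XS; rewrite !inE; lia.
Qed.

Lemma chain_last h : (h <= m)%N ->
  s n h = (cnt X h + ((minn h (a + N - 1)).+1 - a))%N.
Proof.
move=> hm; have [/subsetP XS _ _ fn _] := fX.
rewrite /s (_ : inord n = ord_max); last by apply: val_inj; rewrite /= inordK.
rewrite fn setUC cntU ?cnt_segment //.
by rewrite disjoint_subset; apply/subsetP => x /XS; rewrite !inE; lia.
Qed.

Lemma chain_step t h : (t < n)%N -> (s t h <= s t.+1 h <= s t h.+1)%N.
Proof. by have [_ _ _ _ fI] := fX => /fI/interlacedP/(_ h). Qed.

Lemma chain_mono t h : (t <= n)%N -> (s 0 h <= s t h <= s n h)%N.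
Proof.
move=> tn; apply/andP; split.
  elim: t tn => // t IHt tn; apply: leq_trans (IHt (ltnW tn)) _.
  by case/andP: (chain_step h tn).
have -> : t = (n - (n - t))%N by lia.
elim: (n - t)%N => [|j IHj]; first by rewrite subn0.
have [jn|jn] := leqP n j; first by have -> : (n - j.+1)%N = (n - j)%N by lia.
apply: leq_trans IHj; have /(chain_step h) : (n - j.+1 < n)%N by lia.
by have -> : (n - j.+1).+1 = (n - j)%N; lia.
Qed.

Lemma chain_card t : (t <= n)%N -> #|f (inord t)| = r.
Proof.
move=> tn; rewrite -(cnt_all _ (leqnn m)) -/(s t m).
have := chain_mono m tn; rewrite chain_first // chain_last // cnt_X_high; lia.
Qed.

Lemma chain_below t : (t <= n)%N -> s t a.-1 = 0%N.
Proof.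
by move=> tn; have := chain_mono a.-1 tn; rewrite chain_last ?cnt_X_low; lia.
Qed.

Lemma chain_above t h : (t <= n)%N -> (b <= h)%N -> s t h = r.
Proof.
move=> tn bh; have := chain_mono b tn; have := cnt_mono (f (inord t)) bh.
have := cnt_le (f (inord t)) h; rewrite -/(s t b) -/(s t h) chain_card //.
by rewrite chain_first // cnt_X_high; lia.
Qed.

(** At time 0 all paths are at height at least a + N, and they descend by at most 1 per unit of
    time. Dually, [chain_high] goes back from time n, when all are at height at most b - N. *)
Lemma chain_low t h : (t <= n)%N -> (h + t < a + N)%N -> s t h = 0%N.
Proof.
elim: t h => [|t IHt] h tn ht.
  by rewrite chain_first ?cnt_X_low; lia.
have := chain_step h tn; rewrite (IHt h.+1); lia.
Qed.

Lemma chain_high t h : (t <= n)%N -> (b + k <= h + t)%N -> s t h = r.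
Proof.
move=> tn; have -> : t = (n - (n - t))%N by lia.
elim: (n - t)%N h => [|j IHj] h ht.
  rewrite subn0; have [bh|hb] := leqP b h; first exact: chain_above.
  by rewrite chain_last ?cnt_X_high; lia.
have [jn|jn] := leqP n j.
  by have -> : (n - j.+1)%N = (n - j)%N; [lia | apply: IHj; lia].
case: h ht => [|h] ht; first by lia.
have /(chain_step h) : (n - j.+1 < n)%N by lia.
have -> : (n - j.+1).+1 = (n - j)%N by lia.
rewrite IHj; last by lia.
have := cnt_le (f (inord (n - j.+1))) h.+1; rewrite chain_card /s; lia.
Qed.

Lemma cnt_stepP (A : {set 'I_m}) h : (cnt A h <= cnt A h.+1 <= (cnt A h).+1)%N.
Proof.
have [hm|hm] := ltnP h m.
  by rewrite -[h.+1]/((Ordinal hm).+1) cntS /=; case: (_ \in _); lia.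
by rewrite !cnt_all ?leqnn ?leqnSn // leqW.
Qed.

(** The corrected counts on the window 0 <= t <= n are continued by the period rule; they fit
    together at the ends because both end sets contain the same X ([G_wrap]). *)
Lemma heights_of_chain : exists F, height_function F /\ chain_heights F f.
Proof.
pose G (h t : int) : int := (s `|t| `|h|)%:Z + outside h t.
pose F (h t : int) : int := G h (t %% n%:Z)%Z + N%:Z * (t %/ n%:Z)%Z.
have n0 : (0 < n)%N by rewrite /n; lia.
have G_wrap (h : int) : a%:Z - 1 <= h <= b%:Z -> G h n = G h 0 + N%:Z.
  move=> hab; rewrite /G !absz_nat chain_last ?chain_first; try lia.
  by rewrite /outside /n; do ![case: ifP]; lia.
have FE (h e t : int) : a%:Z - 1 <= h <= b%:Z -> 0 <= t <= n%:Z ->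
    F h (e * n%:Z + t) = G h t + N%:Z * e.
  move=> hab t0n; rewrite /F divzMDl; last by lia.
  rewrite modzMDl; have [tn|tn] := ltP t n.
    by rewrite modz_small ?divz_small; lia.
  have -> : t = n by lia.
  by rewrite modzz divzz G_wrap //; case: eqP; lia.
have F0 (h t : int) : a%:Z - 1 <= h <= b%:Z -> 0 <= t <= n%:Z -> F h t = G h t.
  by move=> hab t0n; have := FE h 0 t hab t0n; rewrite mul0r mulr0 add0r addr0.
have nE : n%:Z = N%:Z + k%:Z by rewrite /n; lia.
exists F; split; last first.
  move=> h t ah hb tn; rewrite F0; try lia.
  by rewrite /G !absz_nat addrK.
have split_t (t : int) : exists e u : int, [/\ t = e * n%:Z + u, 0 <= u & u < n%:Z].
  by have [e [u [tE u0 un _]]] := divz_bounds t n0; exists e, u.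
split=> [h t hab|t t0n|t t0n|h t hab|h t hab|h t hab].
- have [e [u [-> u0 un]]] := split_t t.
  have -> : e * n%:Z + u + n%:Z = (e + 1) * n%:Z + u by lia.
  by rewrite !FE; lia.
- rewrite F0; try lia.
  rewrite /G (_ : `|a%:Z - 1|%N = a.-1) ?chain_below; try lia.
  by rewrite /outside; do ![case: ifP]; lia.
- rewrite F0; try lia.
  rewrite /G absz_nat chain_above; try lia.
  by rewrite /outside; do ![case: ifP]; lia.
- have [e [u [-> u0 un]]] := split_t t.
  rewrite -addrA !FE; try lia.
  rewrite /G (_ : outside (h - 1) (u + 1) = outside h u); last first.
    by rewrite /outside (_ : h - 1 + (u + 1) = h + u) //; lia.
  have /(chain_step `|(h - 1)%R|) : (`|u| < n)%N by lia.
  have -> : `|(h - 1)%R|.+1 = `|h|%N by lia.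
  have -> : `|(u + 1)%R|%N = `|u|.+1 by lia.
  by lia.
- have [e [u [-> u0 un]]] := split_t t.
  rewrite -addrA !FE; try lia.
  have /(chain_step `|h|) : (`|u| < n)%N by lia.
  rewrite /G (_ : `|(u + 1)%R|%N = `|u|.+1); last by lia.
  have : outside h u <= outside h (u + 1) by rewrite /outside; do ![case: ifP]; lia.
  by move=> H1 /andP[H2 _]; rewrite lerD2r lerD // lez_nat.
- have [e [u [-> u0 un]]] := split_t t.
  rewrite !FE; try lia.
  have := cnt_stepP (f (inord `|u|)) `|(h - 1)%R|.
  have hE : `|(h - 1)%R|.+1 = `|h|%N by lia.
  rewrite hE -/(s _ _) -/(s _ _) /G.
  (* In the two corners [outside] itself grows by 1 with h, so the counts have to be constant
     there. *)
  have [lo|lo] := ltP (h + u) (a%:Z + N%:Z).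
    rewrite !chain_low; try lia.
    by rewrite /outside; do ![case: ifP]; lia.
  have [hi|hi] := ltP (b%:Z + k%:Z) (h + u).
    rewrite !chain_high; try lia.
    by rewrite /outside; do ![case: ifP]; lia.
  by rewrite /outside; do ![case: ifP]; lia.
Qed.

End ChainToHeights.

Lemma chain_heights_inj_heights F F' f :
  height_function F -> height_function F' ->
  chain_heights F f -> chain_heights F' f ->
  forall h t : int, a%:Z - 1 <= h <= b%:Z -> F h t = F' h t.
Proof.
move=> hF hF' hf hf' h t hab.
have n0 : (0 < n)%N by rewrite /n; lia.
have [e [u [-> u0 un _]]] := divz_bounds t n0.
rewrite addrC !hf_periods //.
have hE : h = `|h|%N%:Z by lia.
have uE : u = `|u|%N%:Z by lia.
have := hf `|h|%N `|u|%N; have := hf' `|h|%N `|u|%N; rewrite -hE -uE; lia.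
Qed.

Lemma chain_heights_inj_chain F X f X' f' : set_chain X f -> set_chain X' f' ->
  chain_heights F f -> chain_heights F f' -> (X, f) = (X', f').
Proof.
move=> fX fX' hf hf'.
have ff' : f = f'.
  apply/ffunP => t; rewrite -[t]inord_val; set u : nat := t.
  have un : (u <= n)%N := ltn_ord t.
  apply: cnt_inj => h hm.
  have [ha|ha] := leqP h a.-1.
    have := cnt_mono (f (inord u)) ha; have := cnt_mono (f' (inord u)) ha.
    by rewrite (chain_below fX un) (chain_below fX' un) !leqn0 => /eqP-> /eqP->.
  have [hb|hb] := leqP b h.
    by rewrite (chain_above fX un hb) (chain_above fX' un hb).
  by apply/eqP; rewrite -eqz_nat hf ?hf'; lia.
congr pair => //.
(* X is the first set of the chain without its top N heights. *)
have key Y g : set_chain Y g -> Y = g ord0 :\: segment m (b - N).+1 b.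
  move=> [/subsetP YS _ -> _ _]; apply/setP => x; rewrite !inE.
  case: (boolP (x \in Y)) => [/YS|_] /=; first by rewrite inE; lia.
  by case: (_ < _ <= _)%N.
by rewrite (key _ _ fX) (key _ _ fX') ff'.
Qed.

Section HeightsToChain.
Variable F : int -> int -> int.
Hypothesis hF : height_function F.
Let D (h t : int) : int := F h t - outside h t.

(** F h t is squeezed between the bottom value on its diagonal ([hf_shear]) and the bottom value at
    its time plus the height difference ([hf_height]); in this corner the two bounds coincide. *)
Lemma heights_low (h t : int) : 0 <= t <= n%:Z -> a%:Z - 1 <= h <= b%:Z ->
  h + t <= a%:Z - 1 + N%:Z -> D h t = 0.
Proof.
move=> t0 hab ht.
have aa : a%:Z - 1 <= a%:Z - 1 by [].
have := hf_height hF (h := a%:Z - 1) (h' := h) t.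
have := hf_shear hF (h := a%:Z - 1) (h' := h) (h + t).
have -> : h + t - h = t by lia.
have := hf_bottom hF (t := t); have := hf_bottom hF (t := h + t - (a%:Z - 1)).
by rewrite /D /outside; do ![case: ifP]; lia.
Qed.

Lemma heights_high (h t : int) : 0 <= t <= n%:Z -> a%:Z - 1 <= h <= b%:Z ->
  b%:Z + k%:Z <= h + t -> D h t = r%:Z.
Proof.
move=> t0 hab ht.
have := hf_height hF (h := h) (h' := b) t.
have := hf_shear hF (h := h) (h' := b) (h + t).
have -> : h + t - h = t by lia.
have := hf_top hF (t := t); have := hf_top hF (t := h + t - b%:Z).
by rewrite /D /outside; do ![case: ifP]; lia.
Qed.

Lemma heights_mid (h t : int) :
  a%:Z - 1 + N%:Z <= h + t -> h + t <= b%:Z + k%:Z -> D h t = F h t.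
Proof. by rewrite /D /outside; do ![case: ifP]; lia. Qed.

Lemma heights_incr (h t : int) : 0 <= t <= n%:Z -> a%:Z <= h <= b%:Z ->
  D (h - 1) t <= D h t <= D (h - 1) t + 1.
Proof.
move=> t0 hab.
have [lo|lo] := leP (h + t) (a%:Z - 1 + N%:Z); first by rewrite !heights_low; lia.
have [hi|hi] := ltP (b%:Z + k%:Z) (h + t); first by rewrite !heights_high; lia.
rewrite !heights_mid; try lia.
have := hf_up hF t hab; have := hf_diag hF t hab.
have := hf_step hF (h := h - 1) t; lia.
Qed.

Lemma heights_bottom (t : int) : 0 <= t <= n%:Z -> D (a%:Z - 1) t = 0.
Proof.
move=> t0; have := hf_bottom hF t0.
by rewrite /D /outside; do ![case: ifP]; lia.
Qed.

Lemma heights_top (t : int) : 0 <= t <= n%:Z -> D b t = r%:Z.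
Proof.
move=> t0; have := hf_top hF t0.
by rewrite /D /outside; do ![case: ifP]; lia.
Qed.

Lemma heights_time (h t : int) : 0 <= t -> t < n%:Z -> a%:Z - 1 <= h <= b%:Z ->
  D h t <= D h (t + 1).
Proof.
move=> t0 tn hab.
have [lo|lo] := ltP (h + t) (a%:Z - 1 + N%:Z); first by rewrite !heights_low; lia.
have [hi|hi] := leP (b%:Z + k%:Z) (h + t); first by rewrite !heights_high; lia.
by rewrite !heights_mid; try lia; apply: hf_step.
Qed.

Lemma heights_shear (h t : int) : a%:Z <= h <= b%:Z -> D (h - 1) (t + 1) <= D h t.
Proof.
move=> hab; have := hf_diag hF t hab; rewrite /D /outside.
have -> : h - 1 + (t + 1) = h + t by lia.
by lia.
Qed.

Let chain : {ffun 'I_n.+1 -> {set 'I_m}} :=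
  [ffun t : 'I_n.+1 => [set x : 'I_m | (a <= x.+1 <= b)%N &&
                                       (D x.+1 t != D x t)]].

Lemma chainE (t : nat) x : (t <= n)%N ->
  (x \in chain (inord t)) = (a <= x.+1 <= b)%N && (D x.+1 t != D x t).
Proof. by move=> tn; rewrite ffunE inE inordK. Qed.

Lemma cnt_chain_low (t h : nat) : (t <= n)%N -> (h < a)%N ->
  cnt (chain (inord t)) h = 0%N.
Proof.
move=> tn ha; apply/eqP; rewrite cards_eq0; apply/eqP/setP => x.
by rewrite !inE chainE //; lia.
Qed.

Lemma cnt_chain (t h : nat) : (t <= n)%N -> (a <= h.+1)%N -> (h <= b)%N ->
  (cnt (chain (inord t)) h)%:Z = D h t.
Proof.
move=> tn; elim: h => [|h IHh] ah hb.
  rewrite cnt0 -[LHS](heights_bottom (t := t)); last by lia.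
  by congr D; lia.
have [ha|ha] := ltnP h.+1 a.
  rewrite cnt_chain_low //; have -> : h.+1%:Z = a%:Z - 1 by lia.
  by rewrite heights_bottom; lia.
have hm : (h < m)%N by lia.
rewrite -[h.+1]/((Ordinal hm).+1) cntS /= chainE //= PoszD IHh //; try lia.
have := heights_incr (h := h.+1) (t := t).
have -> : h.+1%:Z - 1 = h%:Z by lia.
by case: (D h.+1 t =P D h t); lia.
Qed.

Lemma cnt_chain_high (t h : nat) : (t <= n)%N -> (b <= h)%N ->
  cnt (chain (inord t)) h = r.
Proof.
move=> tn bh; apply/eqP; rewrite -eqz_nat -(heights_top (t := t)); last by lia.
rewrite -cnt_chain //; last by lia.
rewrite eqz_nat; apply/eqP; congr #|pred_of_set _|; apply/setP => x.
by rewrite !inE chainE //; lia.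
Qed.

(** X is the part of the first set at heights at most b - N. [D0] shows that the N heights above are
    filled at time 0, [Dn] that the N lowest are filled at time n, and [D0n] that between them the
    two end sets agree, by periodicity. *)
Lemma chain_of_heights : exists X f, set_chain X f /\ chain_heights F f.
Proof.
exists [set x in chain ord0 | (x < b - N)%N], chain; split; last first.
  by move=> h t ah hb tn; rewrite cnt_chain.
have in0 : inord 0 = ord0 :> 'I_n.+1 by apply: val_inj; rewrite /= inordK.
have inn : inord n = ord_max :> 'I_n.+1 by apply: val_inj; rewrite /= inordK.
have nE : n%:Z = N%:Z + k%:Z by rewrite /n; lia.
have D0n (h : int) : a%:Z - 1 + N%:Z <= h -> h <= b%:Z - N%:Z -> D h n = D h 0 + N%:Z.
  move=> h1 h2; rewrite !heights_mid; try lia.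
  by rewrite -(hf_period hF) ?add0r //; lia.
have Dn (h : int) : a%:Z - 1 <= h -> h <= a%:Z - 1 + N%:Z -> D h n = h - (a%:Z - 1).
  move=> h1 h2; rewrite !heights_mid; try lia.
  have : F h n = F h 0 + N%:Z by rewrite -(hf_period hF) ?add0r //; lia.
  have : D h 0 = 0 by apply: heights_low; lia.
  by rewrite /D /outside; do ![case: ifP]; lia.
have D0 (h : int) : b%:Z - N%:Z <= h -> h <= b%:Z -> D h 0 = r%:Z - (b%:Z - h).
  move=> h1 h2; rewrite !heights_mid; try lia.
  have : D h n = r by apply: heights_high; lia.
  have : F h n = F h 0 + N by rewrite -(hf_period hF) ?add0r //; lia.
  rewrite /D /outside.
  by do ![case: ifP]; lia.
have chain0E x : (x \in chain ord0) = (a <= x.+1 <= b)%N && (D x.+1 0 != D x 0).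
  by rewrite -in0 chainE.
have XE x : (x \in [set x in chain ord0 | (x < b - N)%N]) =
    [&& (a <= x.+1 <= b)%N, D x.+1 0 != D x 0 & (x < b - N)%N].
  by rewrite inE chain0E -andbA.
split.
- apply/subsetP => x; rewrite XE inE => /and3P[x1 x2 x3].
  have [lo|lo] := ltnP x.+1 (a + N); last by lia.
  by move: x2; rewrite !heights_low //; lia.
- apply/eqP; rewrite -eqz_nat -in0 -[#|_|]/(cnt (chain (inord 0)) (b - N)).
  by rewrite cnt_chain; try lia; rewrite D0; lia.
- apply/setP => x; rewrite in_setU XE inE chain0E.
  have [lo|lo] := ltnP x (b - N); first by rewrite andbT; lia.
  have [xb|xb] := leqP x.+1 b; last by lia.
  by rewrite !D0; lia.
- apply/setP => x; rewrite in_setU XE inE -inn chainE //.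
  have [xab|xab] := boolP (a <= x.+1 <= b)%N; last by lia.
  have [lo|lo] := ltnP x.+1 (a + N).
    by rewrite !Dn; lia.
  have [hi|hi] := ltnP x (b - N); last by rewrite !andbF orbF !heights_high; lia.
  by rewrite !D0n; lia.
move=> j jn; apply/interlacedP => h.
have [ha|ha] := ltnP h.+1 a; first by rewrite !cnt_chain_low; lia.
have [hb|hb] := leqP b h; first by rewrite !cnt_chain_high; lia.
have E1 := cnt_chain (t := j) (h := h); have E2 := cnt_chain (t := j.+1) (h := h).
have E3 := cnt_chain (t := j) (h := h.+1).
have := heights_time (h := h) (t := j); have := heights_shear (h := h.+1) j.
have -> : h.+1%:Z - 1 = h%:Z by lia.
have -> : j%:Z + 1 = j.+1%:Z by lia.
lia.
Qed.

End HeightsToChain.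
End SetChains.

(** * The weight-preserving correspondence *)

Section Bijection.
Variable s : skew_shape.
Hypothesis cellsE : forall p q : nat, ((p, q) \in cells s) =
  [&& (0 < q)%N, (q <= k)%N, (0 < p)%N & p%:Z <= top_col q].
Implicit Types (T : filling m s) (X : {set 'I_m}) (f : {ffun 'I_n.+1 -> {set 'I_m}}).

Lemma stays_lt (A B : {set 'I_m}) x : interlaced A B ->
  stays A B x = (cnt B x < cnt A x.+1)%N.
Proof.
by move=> /interlacedP/(_ x); rewrite /stays cntS; case: (x \in A); lia.
Qed.

(** The two points compared lie on one diagonal, where [outside] is constant, so counts may be
    replaced by F; no path stays at a height outside [a, b]. *)
Lemma stays_heights F X f (j : nat) (x : 'I_m) : set_chain X f ->
  chain_heights F f -> (j < n)%N ->
  stays (f (inord j)) (f (inord j.+1)) x =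
  (a <= x.+1 <= b)%N && (F x (j%:Z + 1) < F x.+1 j).
Proof.
move=> fX fF jn; have [_ _ _ _ fI] := fX; rewrite stays_lt ?fI //.
have [xa|xa] := ltnP x.+1 a.
  have xa' : (x.+1 <= a.-1)%N by lia.
  have := cnt_mono (f (inord j)) xa'.
  by rewrite (chain_below fX (ltnW jn)) leqn0 => /eqP ->.
have [xb|xb] := leqP b x.
  rewrite (chain_above fX jn xb) andbF.
  by have := cnt_le (f (inord j)) x.+1; rewrite (chain_card fX (ltnW jn)); lia.
have e1 : (cnt (f (inord j)) x.+1)%:Z = F x.+1 j - outside x.+1 j by apply: fF; lia.
have e2 : (cnt (f (inord j.+1)) x)%:Z = F x j.+1 - outside x.+1 j.
  by rewrite fF; try lia; rewrite /outside (_ : x%:Z + j.+1%:Z = x.+1%:Z + j%:Z); lia.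
have -> : j%:Z + 1 = j.+1%:Z by lia.
by rewrite -ltz_nat e1 e2 ltrD2r.
Qed.

Lemma tableau_entry F T (c : seq_sub (cells s)) : height_function F ->
  tableau_heights F T ->
  [/\ a%:Z <= (T c).+1%:Z <= b%:Z,
      F (T c).+1 (diagonal (val c) - (T c).+1%:Z) = (val c).1%:Z &
      F ((T c).+1%:Z - 1) (diagonal (val c) - (T c).+1%:Z + 1) = (val c).1%:Z - 1].
Proof.
move=> hF hT; have := tableau_heights_letters cellsE hF hT c.
have := hT c; set v : nat := T c; set d : int := diagonal _; set p : nat := (val c).1.
clearbody v d p => hc vab; have vab' : a%:Z <= v.+1%:Z <= b%:Z by lia.
have h1 := hc v.+1%:Z; have h2 := hc v%:Z.
have := hf_up hF (d - v.+1%:Z) vab'; have := hf_diag hF (d - v.+1%:Z) vab'.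
have := hf_step hF (h := v) (d - v.+1%:Z).
have E1 : v.+1%:Z - 1 = v%:Z by lia.
have E2 : d - v.+1%:Z + 1 = d - v%:Z by lia.
rewrite E1 E2 => *; split; lia.
Qed.

(** Sending a cell to the time modulo n and the height of its stay is a bijection onto the stays of
    the chain. *)
Lemma tableau_chain_weight (S : comNzRingType) (g : 'I_m -> int -> S) F T X f :
  (forall x u e, g x (u + e * n%:Z) = g x u) ->
  height_function F -> tableau_heights F T -> set_chain X f -> chain_heights F f ->
  \prod_c g (T c) (diagonal (val c)) =
  \prod_(j < n) \prod_(x | stays (f (inord j)) (f (inord j.+1)) x) g x (x.+1 + j)%N.
Proof.
move=> g_period hF hT fX hf.
have n0 : (0 < n)%N by rewrite /n; lia.
have nE : n%:Z = N%:Z + k%:Z by rewrite /n; lia.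
have col_ex c : exists j : 'I_n, exists e : int,
    diagonal (val c) - (T c).+1%:Z = e * n%:Z + j%:Z.
  have [e [u [uE u0 un _]]] := divz_bounds (diagonal (val c) - (T c).+1%:Z) n0.
  have un' : (`|u| < n)%N by lia.
  by exists (Ordinal un'), e; rewrite uE /=; lia.
have [J hJ] := choice col_ex; have [e he] := choice hJ.
pose phi c := (J c, T c).
have phi_inj : injective phi.
  move=> c c' [Jcc' Tcc']; apply: val_inj.
  have := tableau_entry c hF hT; have := tableau_entry c' hF hT.
  have := he c; have := he c'; rewrite -Jcc' -Tcc'.
  have := cell_bounds cellsE c; have := cell_bounds cellsE c'; rewrite /diagonal.
  case: (val c) (val c') => [p q] [p' q']; rewrite ![(_, _).1]/= ![(_, _).2]/=; set h : int := (T c).+1%:Z.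
  set j : int := J c; set ec := e c; set ec' := e c'; clearbody h j ec ec'.
  move=> b' b1 E' E [_ F2 _] [hab F1 _].
  have hab' : a%:Z - 1 <= h <= b%:Z by lia.
  rewrite E addrC hf_periods // in F1; rewrite E' addrC hf_periods // in F2.
  (* Columns of cells with the same stay differ by a multiple of k, and both lie in [1, k]. *)
  have ee : ec = ec'.
    have : (ec - ec') * k%:Z = q'%:Z - q%:Z by rewrite nE in E E'; lia.
    by nia.
  by rewrite ee in F1 E; congr pair; lia.
rewrite pair_big_dep /=.
pose G (jx : 'I_n * 'I_m) := g jx.2 (jx.2.+1 + jx.1)%N.
transitivity (\prod_(c in [set: seq_sub (cells s)]) G (phi c)).
  rewrite [RHS](eq_bigl predT) => [|c]; last by rewrite inE.
  apply: eq_bigr => c _.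
  have -> : G (phi c) = g (T c) ((T c).+1%:Z + (J c)%:Z) by [].
  rewrite -(g_period (T c) ((T c).+1%:Z + (J c)%:Z) (e c)); congr (g _ _).
  by rewrite -addrA [_ + e c * _]addrC -he addrC subrK.
rewrite -(big_imset G) /=; last by move=> c c' _ _; apply: phi_inj.
apply: eq_bigl => -[j x] /=; rewrite (stays_heights _ fX hf (ltn_ord j)).
apply/imsetP/andP => [[c _ [-> ->]]|[xab jx]].
  have [hab F1 F2] := tableau_entry c hF hT.
  move: (he c) F1 F2 hab; set p : nat := (val c).1.
  set h : nat := T c; set jc : nat := J c; move=> -> F1 F2 hab.
  have hab' : a%:Z - 1 <= h.+1%:Z <= b%:Z by lia.
  have hab'' : a%:Z - 1 <= h.+1%:Z - 1 <= b%:Z by lia.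
  rewrite addrC hf_periods // in F1.
  rewrite -addrA addrC hf_periods // in F2.
  have E1 : h.+1%:Z - 1 = h%:Z by lia.
  rewrite E1 in F2; split; first by lia.
  by rewrite -(ltrD2r (e c * N%:Z)) F2 F1; lia.
(* Conversely, this stay is made by path P; shifting by E periods brings its column into [1, k], and
   the two rims show that the result is a cell. *)
set h : int := x.+1%:Z; set P : int := F h j.
have hab : a%:Z <= h <= b%:Z by lia.
have hab' : a%:Z - 1 <= h <= b%:Z by lia.
have hab'' : a%:Z - 1 <= h - 1 <= b%:Z by lia.
have E1 : x%:Z = h - 1 by rewrite /h; lia.
have [E [u [uE u0 uk _]]] := divz_bounds (n%:Z + a%:Z - 1 + P - (h + j%:Z) - 1) k_gt0.
pose q : int := u + 1; pose p : int := P + E * N%:Z.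
have dE : n%:Z + a%:Z - 1 - q + p = h + j%:Z + E * n%:Z by rewrite /q /p nE; lia.
have F1 : F h (h + j%:Z + E * n%:Z - h) = p.
  by rewrite (_ : _ - h = j%:Z + E * n%:Z) ?hf_periods //; lia.
have F2 : F (h - 1) (h + j%:Z + E * n%:Z - (h - 1)) < p.
  rewrite (_ : _ - (h - 1) = j%:Z + 1 + E * n%:Z); last by lia.
  by rewrite hf_periods // /p ltrD2r -E1.
have p_gt0 : 0 < p.
  have := hf_bottom_col hF p q; rewrite (botc_base (q := q)); last by lia.
  have := hf_shear hF (h := a%:Z - 1) (h' := h - 1) (h + j%:Z + E * n%:Z).
  rewrite -dE in F2 *.
  have -> : n%:Z + a%:Z - 1 - q + p - (a%:Z - 1) = n%:Z - q + p by lia.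
  by lia.
have p_le : p <= top_col q.
  rewrite -(hf_top_col hF).
  by have := hf_shear hF (h := h) (h' := b) (h + j%:Z + E * n%:Z); rewrite dE; lia.
have pE : p = `|p|%N%:Z by lia.
have qE : q = `|q|%N%:Z by lia.
have cin : (`|p|%N, `|q|%N) \in cells s by rewrite cellsE -pE -qE p_le; lia.
pose c : seq_sub (cells s) := SeqSub cin; exists c; first by rewrite inE.
have cd : diagonal (val c) = h + j%:Z + E * n%:Z by rewrite /diagonal /= -pE -qE.
have T1 := hT c _ hab'; have T2 := hT c _ hab''.
have cp : (val c).1%:Z = p by rewrite pE.
rewrite cd cp F1 lexx in T1; rewrite cd cp [RHS]leNgt F2 /= in T2.
have Tc : T c = x.
  by apply: ord_inj; move: T1 T2; rewrite /h; set v : nat := T c; clearbody v; lia.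
rewrite /phi Tc; congr pair; apply: ord_inj.
have := he c; rewrite Tc cd -/h => H.
have : (j%:Z == J c %[mod n%:Z])%Z.
  have jE : j%:Z = (e c - E) * n%:Z + J c by lia.
  by rewrite [X in (X == _ %[mod _])%Z]jE modzMDl.
by rewrite !modz_nat !modn_small // eqz_nat => /eqP.
Qed.

(** On the diagonal of the position (0, k), F is nonnegative at height a - 1 and increases up to
    height b. Consequently no chain exists when the removed shape is undefined. *)
Lemma set_chain_top_col X f : set_chain X f -> 0 <= top_col k.
Proof.
move=> fX; have [F [hF _]] := heights_of_chain fX.
have low : 0 <= F (a%:Z - 1) (n%:Z - k%:Z + 0).
  by rewrite (hf_bottom_col hF) botc_base; lia.
rewrite -(hf_top_col hF); apply: le_trans low _.
have -> : n%:Z - k%:Z + 0 = n%:Z + a%:Z - 1 - k%:Z + 0 - (a%:Z - 1) by lia.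
by apply: (hf_shear hF); lia.
Qed.

Theorem sum_tableaux_chains (S : comNzRingType) (g : 'I_m -> int -> S) :
  (forall x u e, g x (u + e * n%:Z) = g x u) -> 0 <= top_col k ->
  \sum_(T : filling m s | `[< cylindric_tableau n k T >] && letters_in T)
     \prod_c g (T c) (diagonal (val c)) =
  \sum_(Xf : {set 'I_m} * {ffun 'I_n.+1 -> {set 'I_m}} | `[< set_chain Xf.1 Xf.2 >])
     \prod_(j < n) \prod_(x | stays (Xf.2 (inord j)) (Xf.2 (inord j.+1)) x)
        g x (x.+1 + j)%N.
Proof.
move=> g_period topk.
apply: (sum_correspondence (R := fun (T : filling m s) Xf => exists F, [/\ height_function F,
    tableau_heights F T & chain_heights F Xf.2])).
- move=> T /andP[/asboolP T_cyl T_ab].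
  have [F [hF hT]] := heights_of_tableau cellsE topk T_cyl T_ab.
  have [X [f [fX hf]]] := chain_of_heights hF.
  by exists (X, f); [apply/asboolP | exists F].
- move=> [X f] /asboolP fX; have [F [hF hf]] := heights_of_chain fX.
  have [T hT] := tableau_of_heights cellsE hF.
  exists T; last by exists F.
  apply/andP; split; first exact/asboolP/(tableau_heights_cylindric cellsE hF hT).
  by apply/forallP => c; exact: (tableau_heights_letters cellsE hF hT c).
- move=> T [X f] [X' f'] _ /asboolP fX /asboolP fX' [F [hF hT hf]] [F' [hF' hT' hf']].
  apply: (chain_heights_inj_chain fX fX' hf) => h t ha hb tn.
  by rewrite hf' // (tableau_heights_inj_heights cellsE hF hF' hT hT'); lia.
- move=> T T' [X f] _ _ /asboolP fX [F [hF hT hf]] [F' [hF' hT' hf']].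
  apply: (tableau_heights_inj_tableau cellsE hF hT) => c h hab.
  by rewrite hT' // (chain_heights_inj_heights hF hF' hf hf').
- move=> T [X f] _ /asboolP fX [F [hF hT hf]].
  exact: tableau_chain_weight hF hT fX hf.
Qed.

End Bijection.

End HeightFunctions.

(** * The theorem *)

Lemma indet_mod_period (R : realType) m n (x : 'I_m) (u e : int) :
  indet_mod R n x (u + e * n%:Z) = indet_mod R n x u.
Proof.
rewrite /indet_mod (@eq_pick _ _
  (fun j : 'I_n => (j.+1%:Z == u - x.+1%:Z + 1 %[mod n%:Z])%Z)) // => j.
rewrite (_ : u + e * n%:Z - x.+1%:Z + 1 = e * n%:Z + (u - x.+1%:Z + 1)).
  by rewrite modzMDl.
by lia.
Qed.

(** A stay at height x + 1 from time j to j + 1 lies on the diagonal x + 1 + j and uses the diagonal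
    entry of factor j. *)
Lemma indet_mod_ord (R : realType) m n (x : 'I_m) (j : 'I_n) :
  indet_mod R n x (x.+1 + j)%N = indet R x j.
Proof.
rewrite /indet_mod.
have E : (x.+1 + j)%N%:Z - x.+1%:Z + 1 = j.+1%:Z by lia.
rewrite E; case: pickP => [j'|/(_ j)]; last by rewrite eqxx.
rewrite -[j'.+1]addn1 -[j.+1]addn1 !PoszD eqz_modDr !modz_nat !modn_small //.
by rewrite eqz_nat => /eqP/ord_inj ->.
Qed.

Lemma Mbar_bidiagonal (R : realType) m n :
  Mbar R m n = \big[mulmx/1%:M]_(j < n)
    bidiagonal (fun x : 'I_m => indet_mod R n x (x.+1 + j)%N).
Proof.
apply: eq_bigr => j _; apply/matrixP => p q; rewrite !mxE.
by case: eqP => // _; rewrite indet_mod_ord.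
Qed.

Lemma cyl_loop_schur_rectangle (R : realType) (m N k a b d : nat) :
  (0 < k)%N -> (0 < a)%N -> (a <= b)%N -> (b <= m)%N ->
  (N + N + d + a <= b.+1)%N ->
  cyl_loop_schur_opt R m (N + k)%N k a b ((N + k)%N%:Z + a%:Z - 1)
    (removal_iter (N + k)%N k d (nseq (b.+1 - a - N) k, [::])) =
  \sum_(X : {set 'I_m} | (X \subset segment m (a + N) (b - N)) &&
                         (#|X| == b.+1 - a - N - d - N)%N)
    minor (X :|: segment m (b - N).+1 b) (segment m a (a + N - 1) :|: X)
      (Mbar R m (N + k)).
Proof.
move=> k0 a0 ab bm dM; set n := (N + k)%N; set r := (b.+1 - a - N - d)%N.
have Nr : (N <= r)%N by rewrite /r; lia.
have rM : (r + N + a <= b.+1)%N by rewrite /r; lia.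
have colE q : removed_col N k (b.+1 - a - N) d q = top_col N k a b r q.
  rewrite /removed_col /top_col.
  have -> : (b.+1 - a - N - r)%N = d by rewrite /r; lia.
  by rewrite /r; lia.
rewrite Mbar_bidiagonal.
under [RHS]eq_bigr => X _ do
  rewrite (minor_prod_bidiagonal n (fun j (x : 'I_m) => indet_mod R n x (x.+1 + j)%N)).
rewrite pair_big_dep /=.
rewrite (eq_bigl (fun Xf : {set 'I_m} * {ffun 'I_n.+1 -> {set 'I_m}} =>
    `[< set_chain a b r Xf.1 Xf.2 >])); last first.
  move=> [X f] /=; apply/andP/asboolP => [[/andP[XS /eqP Xr] /and3P[/eqP f0 /eqP fn /forallP fI]]|].
    by split=> // j jn; have := fI (Ordinal jn).
  move=> [XS Xr f0 fn fI]; rewrite XS Xr f0 fn !eqxx; split=> //=.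
  by apply/forallP => j; apply: fI.
have := removal_iter_rectangle N (b.+1 - a - N) k0 d; rewrite colE -/n.
case: ifP => [topk [la -> la_cols]|topk -> /=]; last first.
  (* The shape is undefined and there is no chain: both sides are 0. *)
  rewrite big1 // => -[X f] /asboolP /(set_chain_top_col k0 a0 ab Nr rM bm).
  by rewrite topk.
have cellsE := removal_iter_cells k0 la_cols.
rewrite /cyl_loop_schur_opt /cyl_loop_schur.
have cellsE' p q : ((p, q) \in cells (la, [::])) =
    [&& (0 < q)%N, (q <= k)%N, (0 < p)%N & p%:Z <= top_col N k a b r q].
  by rewrite -colE cellsE.
rewrite -(sum_tableaux_chains k0 a0 ab Nr rM bm cellsE'
  (@indet_mod_period R m n) topk).
apply: eq_bigr => T _; apply: eq_bigr => c _; congr (indet_mod _ _ _ _).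
by rewrite /content /diagonal; move: (val c) => [p q] /=; lia.
Qed.

Theorem theorem6p12 (R : realType) (m n : nat) (hm : (1 <= m)%N) (hn : (1 <= n)%N) :
  (forall i d : nat,
     (1 <= i <= minn m n)%N -> (d + 2 * i <= m + 2)%N ->
     cyl_loop_schur_opt R m n (n - i + 1)%N 1 m n%:Z
       (removal_iter n (n - i + 1)%N d
          (nseq (m - i + 1)%N (n - i + 1)%N, [::]))
     = \sum_(X : {set 'I_m} | (X \subset segment m i (m - i + 1)%N) &&
                              (#|X| == m + 2 - 2 * i - d)%N)
         minor (X :|: segment m (m - i + 2)%N m)
               (segment m 1 (i - 1)%N :|: X)
               (Mbar R m n))
  /\
  (forall a b i d : nat,
     (1 <= a)%N -> (a <= b)%N -> (b <= m)%N ->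
     (1 <= i <= minn (b - a + 1) n)%N -> (d + 2 * i <= b - a + 3)%N ->
     cyl_loop_schur_opt R m n (n - i + 1)%N a b (n%:Z + a%:Z - 1)
       (removal_iter n (n - i + 1)%N d
          (nseq (b - a + 2 - i)%N (n - i + 1)%N, [::]))
     = \sum_(X : {set 'I_m} |
               (X \subset segment m (a + i - 1)%N (b - i + 1)%N) &&
               (#|X| == b - a + 3 - 2 * i - d)%N)
         minor (X :|: segment m (b - i + 2)%N b)
               (segment m a (a + i - 2)%N :|: X)
               (Mbar R m n)).
Proof.
have general (a b i d : nat) :
     (1 <= a)%N -> (a <= b)%N -> (b <= m)%N ->
     (1 <= i <= minn (b - a + 1) n)%N -> (d + 2 * i <= b - a + 3)%N ->
     cyl_loop_schur_opt R m n (n - i + 1)%N a b (n%:Z + a%:Z - 1)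
       (removal_iter n (n - i + 1)%N d
          (nseq (b - a + 2 - i)%N (n - i + 1)%N, [::]))
     = \sum_(X : {set 'I_m} |
               (X \subset segment m (a + i - 1)%N (b - i + 1)%N) &&
               (#|X| == b - a + 3 - 2 * i - d)%N)
         minor (X :|: segment m (b - i + 2)%N b)
               (segment m a (a + i - 2)%N :|: X)
               (Mbar R m n).
  move=> a0 ab bm i_le d_le.
  (* The substitution N = i - 1, k = n - i + 1 removes the truncated subtractions. *)
  have [N [k [k0 iE nE]]] : exists N k, [/\ (0 < k)%N, i = N.+1 & n = (N + k)%N].
    by exists i.-1, (n - i + 1)%N; split; lia.
  subst i n.
  have := @cyl_loop_schur_rectangle R m N k a b d k0 a0 ab bm.
  have -> : (N + k - N.+1 + 1)%N = k by lia.
  have -> : (b - a + 2 - N.+1)%N = (b.+1 - a - N)%N by lia.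
  have -> : (a + N.+1 - 1)%N = (a + N)%N by lia.
  have -> : (b - N.+1 + 1)%N = (b - N)%N by lia.
  have -> : (b - a + 3 - 2 * N.+1 - d)%N = (b.+1 - a - N - d - N)%N by lia.
  have -> : (b - N.+1 + 2)%N = (b - N).+1 by lia.
  have -> : (a + N.+1 - 2)%N = (a + N - 1)%N by lia.
  by apply; lia.
split=> // i d i_le d_le.
have := general 1%N m i d isT hm (leqnn m).
have -> : n%:Z + 1%N%:Z - 1 = n%:Z by lia.
have -> : (m - 1 + 2 - i)%N = (m - i + 1)%N by lia.
have -> : (1 + i - 1)%N = i by lia.
have -> : (m - 1 + 3 - 2 * i - d)%N = (m + 2 - 2 * i - d)%N by lia.
have -> : (1 + i - 2)%N = (i - 1)%N by lia.
by apply; lia.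
Qed.
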